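(* In the deterministic $\mathsf{LOCAL}$ model, there is no distributed algorithm that solves weak $2$-coloring on all graphs in which every node has odd degree and whose running time on graphs of maximum degree $\Delta$ is $T(\Delta)$ for some function $T$ with $T(\Delta)\in o(\log^*\Delta)$.
   Context: Weak $2$-coloring: each node outputs a color from $\{1,2\}$ such that every node of degree at least $1$ has at least one neighbor with a different color. $\mathsf{LOCAL}$ model: the nodes of the (simple, connected) input graph with $n$ nodes and maximum degree $\Delta$ are processors with globally unique identifiers that are $O(\log n)$-bit strings; each node knows $n$ and $\Delta$; computation proceeds in synchronous rounds in which every node sends arbitrarily large messages to its neighbors and performs arbitrary local computation; the running time is the number of rounds until all nodes have terminated and produced their outputs, in the worst case. $\log^*$ is the iterated logarithm. *)

(* Defs.v *)
From mathcomp Require Import all_boot.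
From mathcomp Require Import finmap.
Set Implicit Arguments. Unset Strict Implicit. Unset Printing Implicit Defensive.
Local Open Scope fset_scope.

Definition simple_graph (V : finType) (E : rel V) : Prop :=
  symmetric E /\ irreflexive E.

Definition connected_graph (V : finType) (E : rel V) : Prop :=
  forall u v : V, connect E u v.

Definition deg (V : finType) (E : rel V) (v : V) : nat := #|[set u | E v u]|.

Definition maxdeg (V : finType) (E : rel V) : nat := \max_(v : V) deg E v.

Fixpoint ball (V : finType) (E : rel V) (k : nat) (v : V) : {set V} :=
  match k with
  | 0 => [set v]
  | k'.+1 => ball E k' v :|: [set u | [exists w in ball E k' v, E w u]]
  end.

(* The radius-T view of v: its own identifier, the identifiers of all nodes
   within distance T, and the (identifier-labelled) edges of the subgraph
   induced by the radius-T ball.  Since identifiers are unique, this is the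
   radius-T ball up to identifier-preserving isomorphism, in canonical form. *)
Definition view := (nat * {fset nat} * {fset (nat * nat)})%type.

Definition view_of (V : finType) (E : rel V) (idf : V -> nat) (T : nat) (v : V)
  : view :=
  let B := ball E T v in
  (idf v,
   [fset idf x | x in B],
   [fset (idf p.1, idf p.2) | p in [set p : V * V |
        [&& E p.1 p.2, p.1 \in B & p.2 \in B]]]).

(* A deterministic LOCAL algorithm with running time T(Delta): each node
   outputs A n Delta (its radius-T(Delta) view); nodes know n and Delta.
   Output colour in bool = {1,2}. *)
Definition algorithm := nat -> nat -> view -> bool.

Definition weak_2_coloring (V : finType) (E : rel V) (col : V -> bool) : Prop :=
  forall v : V, 0 < deg E v -> exists u : V, E v u /\ col u != col v.

(* A solves weak 2-colouring in time T on all (simple, connected) graphs in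
   which every node has odd degree, with identifiers that are c*log n - bit
   strings, i.e. injective identifiers in {0, ..., n^c - 1}. *)
Definition solves_odd_weak2col (c : nat) (T : nat -> nat) (A : algorithm) : Prop :=
  forall (V : finType) (E : rel V) (idf : V -> nat),
    simple_graph E -> connected_graph E ->
    (forall v, odd (deg E v)) ->
    injective idf -> (forall v, idf v < #|V| ^ c) ->
    weak_2_coloring E
      (fun v => A #|V| (maxdeg E) (view_of E idf (T (maxdeg E)) v)).

Fixpoint log_star_aux (fuel x : nat) : nat :=
  match fuel with
  | 0 => 0
  | f.+1 => if x <= 1 then 0 else (log_star_aux f (trunc_log 2 x)).+1
  end.
Definition log_star (x : nat) : nat := log_star_aux x x.

Definition little_o_log_star (T : nat -> nat) : Prop :=
  forall k : nat, 0 < k -> exists D0 : nat, forall D : nat, D0 <= D ->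
    k * T D <= log_star D.

(* Main.v *)
Require Import Defs.
From mathcomp Require Import all_boot.
From mathcomp Require Import finmap.
From mathcomp Require Import order ssralg ssrnum ssrint archimedean rat perm.
From mathcomp Require Import zify lra.
Set Implicit Arguments. Unset Strict Implicit. Unset Printing Implicit Defensive.
Import Order.TTheory.

(** Round elimination on port-numbered trees.  In a tree whose edges join an odd
    port to an even port, call a labelling by colours and by demanding and
    accepting ports good if every node demands more than it accepts, accepts at
    most K times, and each demanding port leads to another colour or to an
    accepting port.  A weak 2-colouring algorithm of radius T gives a good
    labelling of radius T + 1 with two colours and K = 0.  From a good labelling
    of radius t + 1 one obtains a good labelling of radius t, with bounds on the
    number of colours and on K that do not depend on the degree and grow by a
    bounded number of exponentials; in radius 0 there is none once both port
    classes have more than K elements.  Hence T is at least a constant times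
    log* of the degree.

    Identifiers are removed in two steps.  Ramsey's theorem makes the algorithm
    depend only on the order of the identifiers in the ball.  The nodes of a
    port-numbered tree are placed on the rational line by a ping-pong action in
    which crossing an edge is an increasing map, so the order of a ball is
    determined by its port numbers, whatever node it is seen from. *)

(** * Matchings *)

Section Matching.
Variable T : finType.
Implicit Types (R : rel T) (A S : {set T}) (g : T -> T).

Definition nbhd R S : {set T} := [set y | [exists x in S, R x y]].

Lemma nbhdP R S y : reflect (exists2 x, x \in S & R x y) (y \in nbhd R S).
Proof.
rewrite inE; apply: (iffP existsP) => [[x /andP[xS Rxy]]|[x xS Rxy]].
  by exists x.
by exists x; rewrite xS.
Qed.

(** Hall's theorem, by induction on [#|A|]. A tight nonempty proper subset splits the problem in
    two; without one, every such subset has a spare neighbour, so any edge at [a] may be used and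
    its other end removed. *)
Lemma hall_matching R A :
  (forall S, S \subset A -> #|S| <= #|nbhd R S|) ->
  exists g, {in A &, injective g} /\ {in A, forall x, R x (g x)}.
Proof.
have [n] := ubnP #|A|; elim: n R A => // n IH R A ltAn hallA.
have [A0|[a aA]] := set_0Vmem A.
  by exists id; split=> x; rewrite A0 inE.
case: (boolP [exists S : {set T}, [&& S \proper A, S != set0 & #|nbhd R S| <= #|S|]]).
- case/existsP=> S /and3P[SA S0 leS].
  have sSA := proper_sub SA.
  have [g1 [g1i g1R]] : exists g, {in S &, injective g} /\ {in S, forall x, R x (g x)}.
    apply: IH => [|S' S'S]; first by have := proper_card SA; lia.
    exact: hallA (subset_trans S'S sSA).
  pose R' x y := R x y && (y \notin nbhd R S).
  have [g2 [g2i g2R]] : exists g, {in A :\: S &, injective g} /\ {in A :\: S, forall x, R' x (g x)}.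
    apply: IH => [|S' S'S].
      have : 0 < #|A :&: S| by rewrite (setIidPr sSA) card_gt0.
      by have := cardsID S A; lia.
    have [S'A /eqP S'0] : S' \subset A /\ S' :&: S == set0.
      by move: S'S; rewrite subsetD -setI_eq0 => /andP[].
    have := hallA (S :|: S'); rewrite subUset sSA S'A => /(_ isT).
    rewrite cardsU setIC S'0 cards0 subn0.
    suff -> : nbhd R (S :|: S') = nbhd R S :|: nbhd R' S'.
      by rewrite cardsU; lia.
    apply/setP=> y; rewrite in_setU; apply/nbhdP/orP => [[x]|[]].
    + rewrite inE => /orP[xS Rxy|xS' Rxy]; first by left; apply/nbhdP; exists x.
      case: (boolP (y \in nbhd R S)) => yS; first by left.
      by right; apply/nbhdP; exists x => //; rewrite /R' Rxy.
    + by case/nbhdP=> x xS Rxy; exists x; rewrite // inE xS.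
    + by case/nbhdP=> x xS /andP[Rxy _]; exists x; rewrite // inE xS orbT.
  have g1N x : x \in S -> g1 x \in nbhd R S.
    by move=> xS; apply/nbhdP; exists x; last exact: g1R.
  exists (fun x => if x \in S then g1 x else g2 x); split.
    move=> x y xA yA; case: ifP => xS; case: ifP => yS.
    + exact: g1i.
    + have /g2R/andP[_] : y \in A :\: S by rewrite inE yS.
      by move=> + e; rewrite -e g1N.
    + have /g2R/andP[_] : x \in A :\: S by rewrite inE xS.
      by move=> + e; rewrite e g1N.
    + by apply: g2i; rewrite inE ?xS ?yS.
  move=> x xA; case: ifP => xS; first exact: g1R.
  by have /g2R/andP[] : x \in A :\: S by rewrite inE xS.
- move=> /existsPn noS.
  have : 0 < #|nbhd R [set a]|.
    by have := hallA [set a]; rewrite sub1set cards1; apply.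
  rewrite card_gt0 => /set0Pn[b /nbhdP[_ /set1P -> Rab]].
  pose R' x y := R x y && (y != b).
  have [g [gi gR]] : exists g, {in A :\ a &, injective g} /\ {in A :\ a, forall x, R' x (g x)}.
    apply: IH => [|S SA]; first by have := cardsD1 a A; rewrite aA; lia.
    have [->|S0] := eqVneq S set0; first by rewrite cards0.
    have SpA : S \proper A.
      apply: sub_proper_trans SA _; apply/properP; split; first exact: subD1set.
      by exists a; rewrite // !inE eqxx.
    have := noS S; rewrite SpA S0 /= -ltnNge => ltS.
    have -> : nbhd R' S = nbhd R S :\ b.
      apply/setP=> y; rewrite !inE; apply/existsP/andP.
        by case=> x /and3P[xS Rxy yb]; split=> //; apply/existsP; exists x; rewrite xS.
      by case=> yb /existsP[x /andP[xS Rxy]]; exists x; rewrite xS /R' Rxy.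
    by have := cardsD1 b (nbhd R S); case: (b \in _); lia.
  have gb x : x \in A -> x != a -> g x != b.
    by move=> xA xa; have /gR/andP[] : x \in A :\ a by rewrite !inE xa.
  exists (fun x => if x == a then b else g x); split.
    move=> x y xA yA; case: eqVneq => [->|xa]; case: eqVneq => [->|ya] //.
    + by move=> e; have := gb y yA ya; rewrite -e eqxx.
    + by move=> e; have := gb x xA xa; rewrite e eqxx.
    + by apply: gi; rewrite !inE ?xa ?ya.
  move=> x xA; case: eqVneq => [->//|xa].
  by have /gR/andP[] : x \in A :\ a by rewrite !inE xa.
Qed.

(* Cantor-Bernstein: the two halves of g match each side of U into the other;
   g is kept on W and on the part of U on the other side that W does not use. *)
Lemma bipartite_pairing (U : {set T}) (d : pred T) g :
  {in U &, injective g} -> {in U, forall u, d (g u) != d u} ->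
  exists Z : {set T},
    [/\ Z \subset U, [disjoint Z & g @: Z] & U \subset Z :|: g @: Z].
Proof.
move=> gi gd.
pose U1 := [set u in U | d u]; pose U0 := [set u in U | ~~ d u].
pose e := [rel v w | [&& g v \in U0, g (g v) == w & w \in U1]].
(* The chains of the Cantor-Bernstein argument that begin in [U1]: [e] applies [g] twice, passing
   through [U0], and the starting points lie outside the image of [U0]. *)
pose W := [set v in U1 | [exists u in U1 :\: g @: U0, connect e u v]].
have WU1 v : v \in W -> v \in U1 by rewrite inE => /andP[].
have U1U v : v \in U1 -> v \in U by rewrite inE => /andP[].
have U0U v : v \in U0 -> v \in U by rewrite inE => /andP[].
have Wstart v : v \in U1 -> v \notin g @: U0 -> v \in W.
  move=> vU vg; rewrite inE vU; apply/existsP; exists v.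
  by rewrite inE vg vU connect0.
have Wstep v w : v \in W -> e v w -> w \in W.
  rewrite inE => /andP[_ /existsP[u /andP[uS cuv]]] evw.
  have /and3P[_ _ wU1] := evw; rewrite inE wU1 /=.
  by apply/existsP; exists u; rewrite uS (connect_trans cuv) ?connect1.
have Winv v : v \in W -> v \in g @: U0 -> exists2 w, w \in W & e w v.
  rewrite inE => /andP[vU /existsP[u /andP[uS /connectP[p]]]].
  case/lastP: p => [|p w] /=.
    by move=> _ -> ; move: uS; rewrite inE => /andP[/negP].
  rewrite last_rcons rcons_path => /andP[pp ew] -> _.
  exists (last u p) => //; rewrite inE; apply/andP; split; last first.
    by apply/existsP; exists u; rewrite uS; apply/connectP; exists p.
  case/lastP: p pp {ew} => [|p x]; first by move: uS; rewrite inE => /andP[].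
  by rewrite last_rcons rcons_path => /andP[_ /and3P[]].
exists (W :|: (U0 :\: g @: W)); split.
- apply/subsetP => v; rewrite inE => /orP[/WU1/U1U //|].
  by rewrite inE => /andP[_ /U0U].
- have dW v : v \in W -> d v by move/WU1; rewrite inE => /andP[].
  have dU0 v : v \in U0 -> ~~ d v by rewrite inE => /andP[].
  apply/pred0P => v /=; apply/negP => /andP[vZ /imsetP[w wZ vw]].
  move: vZ wZ; rewrite !in_setU !in_setD => /orP[vW|/andP[vgW vU0]] /orP[wW|/andP[wgW wU0]].
  + by have := gd w (U1U _ (WU1 _ wW)); rewrite -vw (dW v vW) (dW w wW).
  + have [|x xW /and3P[gxU0 /eqP ggx _]] := Winv v vW.
      by rewrite vw imset_f.
    have wE : g x = w.
      by apply: gi; rewrite ?U0U // ggx.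
    by case/negP: wgW; rewrite -wE imset_f.
  + by case/negP: vgW; rewrite vw imset_f.
  + have := gd w (U0U _ wU0); rewrite -vw.
    by have := dU0 _ vU0; have := dU0 _ wU0; case: (d v); case: (d w).
- apply/subsetP => v vU; rewrite in_setU.
  case: (boolP (d v)) => dv; last first.
    have vU0 : v \in U0 by rewrite inE vU.
    case: (boolP (v \in g @: W)) => [/imsetP[w wW ->]|vg].
      by apply/orP; right; apply: imset_f; rewrite in_setU wW.
    by rewrite in_setU in_setD vg vU0 orbT.
  have vU1 : v \in U1 by rewrite inE vU.
  case: (boolP (v \in W)) => [vW|vW]; first by rewrite in_setU vW.
  case: (boolP (v \in g @: U0)) => [|/(Wstart _ vU1)]; last by rewrite (negbTE vW).
  case/imsetP=> w wU0 vE; apply/orP; right; rewrite vE; apply: imset_f.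
  rewrite in_setU in_setD wU0 andbT; apply/orP; right.
  apply: contra vW => /imsetP[x xW wE]; apply: (Wstep x) => //=.
  by rewrite -wE wU0 -vE eqxx.
Qed.

End Matching.

(** * Ramsey's theorem for subsequences *)

Section Ramsey.
Variable T : eqType.
Implicit Types (s t u : seq T) (col : seq T -> bool).

(** Induction on [m], then on [K0 + K1]. The head [a] is set aside, the tail is thinned until
    [col (a :: u)] is constant, and the bound for a smaller pair of targets is applied to it; [a] is
    put back if the colours agree. *)
Lemma ramsey_subseq (m : nat) : forall K0 K1 : nat, exists N : nat, forall col s, N <= size s ->
  exists (b : bool) t, [/\ subseq t s, size t = (if b then K1 else K0) &
    forall u, subseq u t -> size u = m -> col u = b].
Proof.
elim: m => [|m IHm] K0 K1.
  exists (K0 + K1) => col s le; exists (col [::]), (take (if col [::] then K1 else K0) s).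
  split; [exact: take_subseq | by rewrite size_take_min; case: (col _); lia |].
  by move=> u _ /size0nil ->.
have [n] := ubnP (K0 + K1); elim: n K0 K1 => // n IH K0 K1 ltn.
case: K0 ltn => [|K0] ltn.
  by exists 0 => col s _; exists false, [::]; split; rewrite ?sub0seq // => u; rewrite subseq0 => /eqP->.
case: K1 ltn => [|K1] ltn.
  by exists 0 => col s _; exists true, [::]; split; rewrite ?sub0seq // => u; rewrite subseq0 => /eqP->.
have [|N0 N0P] := IH K0 K1.+1; first by lia.
have [|N1 N1P] := IH K0.+1 K1; first by lia.
have [N NP] := IHm N0 N1.
exists N.+1 => col [//|a s] /= le.
have [b [t1 [t1s st1 t1P]]] := NP (fun u => col (a :: u)) s le.
have grow t c K : subseq t t1 -> size t = K -> c = b ->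
    (forall u, subseq u t -> size u = m.+1 -> col u = c) ->
    [/\ subseq (a :: t) (a :: s), size (a :: t) = K.+1 &
      forall u, subseq u (a :: t) -> size u = m.+1 -> col u = c].
  move=> tt1 st cb tP; split=> /=.
  - by rewrite eqxx (subseq_trans tt1).
  - by rewrite st.
  - case=> // x u /=; case: eqP => [->|_] ut su; last exact: tP.
    by rewrite cb; apply: t1P; [exact: subseq_trans ut tt1 | case: su].
have keep t : subseq t t1 -> subseq t (a :: s).
  by move=> tt1; apply: subseq_trans (subseq_cons s a); apply: subseq_trans t1s.
case: b st1 t1P grow => st1 t1P grow.
  have [|[] [t [tt1 st tP]]] := N1P col t1; first by rewrite st1.
    by exists true, (a :: t); apply: (grow t true K1).
  by exists false, t; split=> //; apply: keep.
have [|[] [t [tt1 st tP]]] := N0P col t1; first by rewrite st1.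
  by exists true, t; split=> //; apply: keep.
by exists false, (a :: t); apply: (grow t false K0).
Qed.

(** One set of identifiers has to serve all port views at once. Homogeneity passes to subsequences,
    so the members of [ys] are treated one after the other. *)
Lemma ramsey_family (Y : eqType) (ys : seq Y) (m : Y -> nat) (M : nat) :
  exists N, forall (col : Y -> seq T -> bool) s, N <= size s ->
  exists t, [/\ subseq t s, size t = M &
    {in ys, forall y u u', subseq u t -> subseq u' t -> size u = m y -> size u' = m y ->
       col y u = col y u'}].
Proof.
elim: ys => [|y ys [N NP]].
  by exists M => col s le; exists (take M s); split; rewrite ?take_subseq ?size_take_min //; lia.
have [N' N'P] := ramsey_subseq (m y) N N.
exists N' => col s le; have [b [t1 [t1s st1 t1P]]] := N'P (col y) s le.
have [|t [tt1 st tP]] := NP col t1; first by rewrite st1; case: (b).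
exists t; split=> // [|z]; first exact: subseq_trans t1s.
rewrite inE => /orP[/eqP->|zs] u u' ut u't su su'; last exact: tP.
by rewrite !t1P //; apply: subseq_trans tt1.
Qed.

End Ramsey.

(** * Round elimination *)

(** The elements of [S] are dealt out in blocks of [K.+1], one block for each value in [L];
    everything else gets the default [N0]. *)
Lemma saturating_assignment (T V : finType) (S : {set T}) (L : {set V}) (K : nat) :
  L != set0 -> K.+1 * #|L| <= #|S| ->
  exists w : T -> V, (forall i, w i \in L) /\
    {in L, forall N, K < #|[set i in S | w i == N]|}.
Proof.
case/set0Pn=> N0 N0L leS.
pose w i := nth N0 (enum L) (index i (enum S) %/ K.+1).
exists w; split=> [i|N NL].
  rewrite /w; case: (ltnP (index i (enum S) %/ K.+1) (size (enum L))) => lt.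
    by rewrite -mem_enum mem_nth.
  by rewrite nth_default.
have Ls : 0 < #|L| by apply/card_gt0P; exists N0.
have /card_gt0P[i0 i0S] : 0 < #|S| by lia.
pose r := index N (enum L).
have ltr : r < #|L| by rewrite cardE index_mem mem_enum.
pose z (k : 'I_K.+1) := nth i0 (enum S) (r * K.+1 + k).
have ltk (k : 'I_K.+1) : r * K.+1 + k < size (enum S).
  by rewrite -cardE; have := ltn_ord k; nia.
have zi : injective z.
  move=> k l /eqP; rewrite nth_uniq ?enum_uniq ?ltk // eqn_add2l => /eqP; exact: val_inj.
rewrite -[K.+1]card_ord -(card_imset _ zi); apply: subset_leq_card.
apply/subsetP=> _ /imsetP[k _ ->]; rewrite inE -mem_enum mem_nth ?ltk //=.
rewrite /w /z index_uniq ?enum_uniq ?ltk // divnMDl // divn_small ?ltn_ord // addn0.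
by rewrite nth_index // mem_enum.
Qed.

Section Gap.
Variables (m a : nat).

(** If [m] rare classes have at most [gap_seq s'] elements each, then [2 * m * gap_seq s'] bounds
    the rare elements together with their partners, and a class at the next threshold still has more
    than [a] others. *)
Fixpoint gap_seq (s : nat) : nat :=
  if s is s'.+1 then 2 * m * gap_seq s' + a.+1 else 0.

Lemma gap_seq_mono s t : 0 < m -> s <= t -> gap_seq s <= gap_seq t.
Proof.
move=> m0 /subnK <-; elim: (t - s) => // k IH.
by rewrite addSn /=; nia.
Qed.

(* Values below [gap_seq s] are rare and values above [gap_seq s.+1] are common,
   with a margin that dominates the total weight of the rare ones. *)
Lemma gap_exists (I : finType) (cnt : I -> nat) :
  #|I| = m -> 0 < m ->
  exists2 s, s <= m & forall i, cnt i <= gap_seq s \/ gap_seq s.+1 <= cnt i.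
Proof.
move=> cI m0.
case: (boolP [exists s : 'I_m.+1, [forall i, (cnt i <= gap_seq s) || (gap_seq s.+1 <= cnt i)]]).
  case/existsP=> s /forallP gs; exists s; first by rewrite -ltnS ltn_ord.
  by move=> i; apply/orP.
move=> /existsPn noS.
(* If every index failed, each of the m + 1 disjoint intervals between consecutive thresholds would
   contain a value of [cnt], which has at most [m] values. *)
have /fin_all_exists[b bP] : forall s : 'I_m.+1, exists i, gap_seq s < cnt i < gap_seq s.+1.
  move=> s; have /forallPn[i] := noS s; rewrite negb_or -!ltnNge => ?; by exists i.
have bi : injective b.
  move=> s t e; apply: val_inj; have := bP s; have := bP t; rewrite e => /andP[h1 h2] /andP[h3 h4].
  case: (ltngtP s t) => // lt.
    by have := gap_seq_mono m0 lt; lia.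
  by have := gap_seq_mono m0 lt; lia.
by have := leq_card b bi; rewrite card_ord cI ltnn.
Qed.

End Gap.

(** * Port types, and the sets of types that demand *)

Section Types.
Variables P C : finType.

(* The flags of a port are: demanding, accepting. *)
Definition label : finType := (C * (bool * bool))%type.
(** The side of the port, and the family of its possible output sets, one for each extension of the
    view through it. *)
Definition ptype : finType := (bool * {set {set label}})%type.

(** The edge condition of a good labelling, in one direction, for all outputs possible at the two
    ends. *)
Definition forces (N F : {set label}) : bool :=
  [forall o in N, forall o' in F,
     (o.1 == o'.1) ==> o.2.1 ==> o'.2.2].
Definition orth N F := forces N F && forces F N.

Lemma orthC N F : orth N F = orth F N. Proof. exact: andbC. Qed.

Lemma forcesP N F c s s' :
  forces N F -> (c, s) \in N -> (c, s') \in F -> s.1 -> s'.2.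
Proof.
move=> /forall_inP h hN hF e; have /forall_inP/(_ _ hF) := h _ hN.
by rewrite /= eqxx e.
Qed.

Definition compat (t t' : ptype) : bool :=
  (t.1 != t'.1) && [exists N in t.2, exists F in t'.2, orth N F].

Lemma compatP (t t' : ptype) :
  reflect (t.1 != t'.1 /\ exists N F, [/\ N \in t.2, F \in t'.2 & orth N F]) (compat t t').
Proof.
apply: (iffP andP) => -[h1 h2]; split=> //.
  by case/exists_inP: h2 => N ? /exists_inP[F ? ?]; exists N, F.
case: h2 => N [F [? ? ?]]; apply/exists_inP; exists N => //.
by apply/exists_inP; exists F.
Qed.

(** A bound on the number of ports of rare type: at most [#|ptype|] types, each below the last
    threshold that [gap_exists] can return. *)
Definition next_bound (K : nat) : nat :=
  #|ptype| * gap_seq #|ptype| (K.+1 * #|{set label}|) #|ptype|.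

(* If no set of types works, then by Hall's condition the ports of rare type can
   be paired off inside orthogonal pairs, and every port of common type can be
   given a value that is orthogonal to more than K others.  Such a choice admits
   no good labelling: each demanding port would need its own accepting port. *)
Lemma demanding_types (ty : P -> ptype) (K : nat) :
  (forall v : P -> {set label}, (forall i, v i \in (ty i).2) ->
     exists c (st : P -> bool * bool),
       [/\ forall i, (c, st i) \in v i,
           #|[set i | (st i).2]| < #|[set i | (st i).1]| &
           #|[set i | (st i).2]| <= K]) ->
  exists DD : {set ptype},
    #|[set j | [exists t in DD, compat t (ty j)]]| < #|[set i | ty i \in DD]|
    /\ #|[set j | [exists t in DD, compat t (ty j)]]| <= next_bound K.
Proof.
move=> solv; set K' := next_bound K.
case: (boolP [exists DD : {set ptype},
   (#|[set j | [exists t in DD, compat t (ty j)]]| < #|[set i | ty i \in DD]|)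
   && (#|[set j | [exists t in DD, compat t (ty j)]]| <= K')]).
  by case/existsP=> DD /andP[? ?]; exists DD.
move=> /existsPn noDD; exfalso.
pose R : rel P := fun i j => compat (ty i) (ty j).
(* Trying the types that occur in [S] as [DD] gives Hall's condition for [S], provided that [S] has
   at most [K'] neighbours. *)
have dense S : #|nbhd R S| <= K' -> #|S| <= #|nbhd R S|.
  move=> leS; have := noDD (ty @: S).
  have -> : [set j | [exists t in ty @: S, compat t (ty j)]] = nbhd R S.
    apply/setP=> j; rewrite inE; apply/exists_inP/nbhdP.
      by case=> _ /imsetP[i iS ->] c; exists i.
    by case=> i iS c; exists (ty i); rewrite ?imset_f.
  rewrite leS andbT -leqNgt => /(leq_trans _); apply.
  by apply: subset_leq_card; apply/subsetP=> i iS; rewrite inE imset_f.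
pose m := #|ptype|.
have m0 : 0 < m by apply/card_gt0P; exists (true, set0).
pose h := #|{set label}|.
pose cnt t := #|[set i | ty i == t]|.
have [s les gap] := gap_exists (K.+1 * h) cnt erefl m0; rewrite -/m in gap.
set g := gap_seq m (K.+1 * h) in gap.
have gS : g s.+1 = 2 * m * g s + (K.+1 * h).+1 by [].
pose U := [set i | cnt (ty i) <= g s].
have cardU : #|U| <= m * g s.
  rewrite -sum1_card (partition_big ty predT) //= /m -sum_nat_const.
  apply: leq_sum => t _; rewrite sum1dep_card.
  case: (leqP (cnt t) (g s)) => ct.
    apply: leq_trans ct; apply: subset_leq_card; apply/subsetP=> i.
    by rewrite !inE => /andP[].
  rewrite (eq_card0 (A := [set x | _])) // => i; rewrite !inE.
  by apply/negP => /andP[+ /eqP e]; rewrite e leqNgt ct.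
have leUK : #|U| <= K'.
  apply: (leq_trans cardU); rewrite /K' /next_bound leq_mul2l.
  by rewrite gap_seq_mono ?orbT.
have common i : i \notin U -> g s.+1 <= cnt (ty i).
  by rewrite inE => iU; case: (gap (ty i)) => //; rewrite (negbTE iU).
(* Otherwise all neighbours of the type class of [i] would be rare, and the class, being larger than
   [U], would violate Hall's condition. *)
have partner i : i \notin U -> exists2 j, j \notin U & R i j.
  move=> iU; case: (boolP [exists j, (j \notin U) && R i j]).
    by case/existsP=> j /andP[? ?]; exists j.
  move=> /existsPn noj; exfalso.
  have sU : nbhd R [set k | ty k == ty i] \subset U.
    apply/subsetP=> j /nbhdP[k]; rewrite inE => /eqP e; rewrite /R e => Rij.
    by have := noj j; rewrite /R Rij andbT negbK.
  have := subset_leq_card sU => le1.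
  have := dense _ (leq_trans le1 leUK).
  have := common i iU; rewrite gS /cnt -mulnA.
  by move: le1 cardU; generalize (m * g s) (K.+1 * h); clear; lia.
have [pi [pi_inj piR]] : exists pi, {in U &, injective pi} /\ {in U, forall x, R x (pi x)}.
  apply: hall_matching => S SU.
  case: (leqP #|nbhd R S| K') => [/dense //|lt].
  exact: leq_trans (leq_trans (subset_leq_card SU) leUK) (ltnW lt).
have [Z [ZU disZ UZ]] : exists Z : {set P},
    [/\ Z \subset U, [disjoint Z & pi @: Z] & U \subset Z :|: pi @: Z].
  apply: (bipartite_pairing (d := fun i => (ty i).1)) => // u /piR /compatP[+ _].
  by rewrite eq_sym.
pose V := Z :|: pi @: Z.
have cardV : #|V| <= 2 * #|U|.
  have cZ := subset_leq_card ZU.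
  apply: leq_trans (leq_card_setU _ _) _; rewrite mul2n -addnn leq_add //.
  exact: leq_trans (leq_imset_card _ _) cZ.
have piZ : {in Z &, injective pi}.
  by move=> x y xZ yZ; apply: pi_inj; apply: (subsetP ZU).
have notboth z : z \in Z -> z \notin pi @: Z.
  by move=> zZ; rewrite (disjointFr disZ).
have /fin_all_exists[ab abP] : forall z, exists p : {set label} * {set label},
    z \in Z -> [/\ p.1 \in (ty z).2, p.2 \in (ty (pi z)).2 & orth p.1 p.2].
  move=> z; case: (boolP (z \in Z)) => zZ; last by exists (set0, set0).
  have /piR/compatP[_ [N [F [? ? ?]]]] := subsetP ZU _ zZ.
  by exists (N, F).
pose q i := odflt i [pick z in Z | pi z == i].
have qP z : z \in Z -> q (pi z) = z.
  move=> zZ; rewrite /q; case: pickP => [y /andP[yZ /eqP e]|/(_ z)] /=.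
    exact: piZ e.
  by rewrite zZ eqxx.
(* The values of type [t] that are orthogonal to a value available at some common port of the other
   side. The map [w] below gives each of them to more than [K] unpaired ports. *)
pose L (t : ptype) := [set N in t.2 | [exists j, (j \notin U) && (t.1 != (ty j).1)
   && [exists F in (ty j).2, orth N F]]].
have /fin_all_exists[w wP] : forall t : ptype, exists w : P -> {set label},
    g s.+1 <= cnt t -> L t != set0 -> (forall i, w i \in L t) /\
    {in L t, forall N, K < #|[set i in [set i | ty i == t] :\: V | w i == N]|}.
  move=> t; case: (leqP (g s.+1) (cnt t)) => ct; last by exists (fun=> set0).
  case: (eqVneq (L t) set0) => [->|L0]; first by exists (fun=> set0); rewrite ?eqxx.
  have [|w [w1 w2]] := @saturating_assignment P _ ([set i | ty i == t] :\: V) (L t) K L0.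
    have cL : #|L t| <= h by rewrite max_card.
    have := cardsID V [set i | ty i == t]; rewrite -/(cnt t).
    have := subset_leq_card (subsetIr [set i | ty i == t] V).
    by rewrite gS in ct; nia.
  by exists w.
have L0 i : i \notin U -> L (ty i) != set0.
  move=> /partner[j jU /compatP[hd [N [F [? ? ?]]]]].
  apply/set0Pn; exists N; rewrite inE; apply/andP; split=> //.
  by apply/existsP; exists j; rewrite jU hd; apply/exists_inP; exists F.
have wL i : i \notin U -> w (ty i) i \in L (ty i).
  by move=> iU; have [h1 _] := wP _ (common _ iU) (L0 _ iU).
pose v i := if i \in Z then (ab i).1 else if i \in pi @: Z then (ab (q i)).2 else w (ty i) i.
have nVU i : i \notin V -> i \notin U.
  by apply: contra => /(subsetP UZ).
have vV i : i \notin V -> v i = w (ty i) i.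
  by rewrite in_setU negb_or /v => /andP[/negbTE-> /negbTE->].
have v1 z : z \in Z -> v z = (ab z).1 by rewrite /v => ->.
have v2 z : z \in Z -> v (pi z) = (ab z).2.
  move=> zZ; rewrite /v (imset_f pi zZ) qP // ifF //.
  by apply/negP => /notboth; rewrite imset_f.
have [|c [st [stv ltA leA]]] := solv v.
  move=> i; case: (boolP (i \in V)) => iV.
    case/setUP: iV => [iZ|/imsetP[z zZ ->]].
      by rewrite v1 //; case: (abP i iZ).
    by rewrite v2 //; case: (abP z zZ).
  rewrite vV //; have := wL _ (nVU _ iV).
  by rewrite inE => /andP[].
set A := [set i | (st i).2] in ltA leA.
set D := [set i | (st i).1] in ltA.
(* A demanding port outside [V] would hold a value orthogonal to some [F] held by more than [K]
   unpaired ports, all of which would have to accept. *)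
have DV : D \subset V.
  apply/subsetP=> i; rewrite inE => sti; apply: contraT => iV.
  have iU := nVU _ iV; have := wL _ iU; rewrite inE => /andP[wt /existsP[j]].
  case/andP=> /andP[jU hd] /exists_inP[F Fj oF].
  have FL : F \in L (ty j).
    rewrite inE Fj; apply/existsP; exists i; rewrite iU eq_sym hd.
    by apply/exists_inP; exists (w (ty i) i); rewrite // orthC.
  have [_ /(_ F FL)] := wP _ (common _ jU) (L0 _ jU).
  rewrite ltnNge => /negP[]; apply: leq_trans leA.
  apply: subset_leq_card; apply/subsetP=> l; rewrite !inE => /andP[/andP[lV /eqP e] /eqP wl].
  have := stv l; rewrite vV ?inE // e wl => lF.
  have := stv i; rewrite vV // => iN.
  by case/andP: oF => /forcesP /(_ iN lF sti).
(* Exchanging partners maps demanding ports injectively to accepting ones, against [ltA]. *)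
pose pt i := if i \in Z then pi i else q i.
have pt_inj : {in V &, injective pt}.
  have ptpi z : z \in Z -> pt (pi z) = z.
    move=> zZ; rewrite /pt ifF ?qP //.
    by apply/negP => /notboth; rewrite imset_f.
  have ptz z : z \in Z -> pt z = pi z by rewrite /pt => ->.
  move=> i j /setUP[iZ|/imsetP[z zZ ->]] /setUP[jZ|/imsetP[y yZ ->]].
  + by rewrite !ptz //; apply: piZ.
  + by rewrite ptz // ptpi // => e; have := notboth y yZ; rewrite -e imset_f.
  + by rewrite ptpi // ptz // => e; have := notboth z zZ; rewrite e imset_f.
  + by rewrite !ptpi // => ->.
have ptA i : i \in D -> pt i \in A.
  move=> iD; have := iD; rewrite inE => sti.
  have [iZ|/imsetP[z zZ iE]] := setUP (subsetP DV _ iD).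
    have [_ _ /andP[o1 _]] := abP i iZ.
    rewrite /pt iZ inE.
    apply: (forcesP o1 _ _ sti); first by rewrite -v1.
    by rewrite -v2.
  have [_ _ /andP[_ o2]] := abP z zZ.
  rewrite iE /pt ifF ?qP // ?inE; last first.
    by apply/negP => /notboth; rewrite imset_f.
  rewrite iE in sti; apply: (forcesP o2 _ _ sti); first by rewrite -v2.
  by rewrite -v1.
have : #|D| <= #|A|.
  rewrite -(card_in_imset (f := pt) (D := D)).
    by apply: subset_leq_card; apply/subsetP=> _ /imsetP[i iD ->]; apply: ptA.
  by move=> x y xD yD; apply: pt_inj; apply: (subsetP DV).
by lia.
Qed.

End Types.

(** * Port-numbered views and the elimination step *)

Section PortViews.
Variables (P : finType) (dir : pred P).

(* A view of radius t + 1 is the own view of radius t and, for each port, the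
   port at the other end and the view of radius t of the neighbour, which
   includes the way back. *)
Fixpoint pview (t : nat) : finType :=
  if t is t'.+1 then (pview t' * {ffun P -> P * pview t'})%type else unit.

(* [padj x i x' j]: an edge with port i at x and port j at x' is possible. *)
Fixpoint padj (t : nat) : pview t -> P -> pview t -> P -> bool :=
  match t with
  | 0 => fun _ i _ j => dir i != dir j
  | t'.+1 => fun x i x' j => (x.2 i == (j, x'.1)) && (x'.2 j == (i, x.1))
  end.

Fixpoint pvalid (t : nat) : pview t -> bool :=
  match t with
  | 0 => fun _ => true
  | t'.+1 => fun x => pvalid x.1 &&
      [forall i, pvalid (x.2 i).2 && padj x.1 i (x.2 i).2 (x.2 i).1]
  end.

Lemma padjC t (x x' : pview t) i j : padj x i x' j = padj x' j x i.
Proof. by case: t x x' => [|t] x x' /=; rewrite 1?eq_sym // andbC. Qed.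

Lemma pvalidS t (x : pview t.+1) :
  pvalid x <-> pvalid x.1 /\ forall i, pvalid (x.2 i).2 /\ padj x.1 i (x.2 i).2 (x.2 i).1.
Proof.
split=> /= [/andP[-> /forallP h]|[-> h]]; first by split=> // i; apply/andP.
by apply/forallP=> i; apply/andP.
Qed.

Lemma padj_dir t (x x' : pview t) i j : pvalid x -> padj x i x' j -> dir i != dir j.
Proof.
elim: t x x' => // t IH x x' /pvalidS[vx h] /andP[/eqP e _].
by have [_] := h i; rewrite e /=; apply: IH.
Qed.

Definition solution (t : nat) (C : finType) (K : nat)
    (col : pview t -> C) (st : pview t -> P -> bool * bool) : Prop :=
  (forall x, pvalid x ->
     #|[set i | (st x i).2]| < #|[set i | (st x i).1]| /\ #|[set i | (st x i).2]| <= K) /\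
  (forall x i x' j, pvalid x -> pvalid x' -> padj x i x' j -> col x = col x' ->
     (st x i).1 -> (st x' j).2).

Definition solvable t C K := exists col st, @solution t C K col st.

(* [near y i p] is the set of outputs that remain possible at y when the view is
   extended by p through port i.  Extensions through different ports, and at the
   two ends of an edge, can be chosen independently. *)
Lemma round_elimination t (C : finType) K :
  solvable t.+1 C K -> solvable t {set ptype C} (next_bound C K).
Proof.
case=> col [st [cnt edge]].
pose near (y : pview t) (i : P) (p : P * pview t) : {set label C} :=
  [set o | [exists s : {ffun P -> P * pview t},
     [&& pvalid ((y, s) : pview t.+1), s i == p, col (y, s) == o.1 & st (y, s) i == o.2]]].
pose ty (y : pview t) (i : P) : ptype C :=
  (dir i, [set near y i p | p : P * pview t in [set p | pvalid p.2 && padj y i p.2 p.1]]).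
have orth_near y i z j : padj y i z j -> orth (near y i (j, z)) (near z j (i, y)).
  move=> yz.
  suff F y' i' z' j' : padj y' i' z' j' -> forces (near y' i' (j', z')) (near z' j' (i', y')).
    by rewrite /orth !F // padjC.
  move=> yz'; apply/forall_inP=> -[c a]; rewrite inE => /existsP[s /and4P[vs /eqP si /eqP cs /eqP sts]].
  apply/forall_inP=> -[c' b]; rewrite inE => /existsP[s' /and4P[vs' /eqP si' /eqP cs' /eqP sts']].
  move: cs sts cs' sts' => /= cs sts cs' sts'.
  apply/implyP=> /eqP cc; apply/implyP=> a1; rewrite -sts'.
  apply: (edge (y', s) i' (z', s') j') => //=; first by rewrite si si' !eqxx.
    by rewrite cs cs'.
  by rewrite sts.
have compat_ty y i z j : pvalid y -> pvalid z -> padj y i z j -> compat (ty y i) (ty z j).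
  move=> vy vz yz; apply/compatP; split; first exact: padj_dir yz.
  exists (near y i (j, z)), (near z j (i, y)); split; last exact: orth_near.
    by apply: imset_f; rewrite inE vz yz.
  by apply: imset_f; rewrite inE vy /= padjC.
have /fin_all_exists[DD DDP] : forall y : pview t, exists DD : {set ptype C}, pvalid y ->
    #|[set j | [exists u in DD, compat u (ty y j)]]| < #|[set i | ty y i \in DD]|
    /\ #|[set j | [exists u in DD, compat u (ty y j)]]| <= next_bound C K.
  move=> y; case: (boolP (pvalid y)) => vy; last by exists set0.
  have [|DD] := @demanding_types _ C (ty y) K; last by exists DD.
  move=> v vP.
  have /fin_all_exists[s sP] : forall i, exists p : P * pview t,
      pvalid p.2 && padj y i p.2 p.1 /\ v i = near y i p.
    by move=> i; have /imsetP[p] := vP i; rewrite inE => ? ->; exists p.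
  (* One extension per port is assembled into a single view of radius [t.+1], whose output at each
     port lies in the set chosen there. *)
  pose x : pview t.+1 := (y, [ffun i => s i]).
  have vx : pvalid x.
    apply/pvalidS; split=> // i; rewrite ffunE.
    by have [/andP[]] := sP i.
  exists (col x), (st x); have [? ?] := cnt x vx; split=> // i.
  have [_ ->] := sP i; rewrite inE; apply/existsP; exists [ffun i => s i].
  by rewrite vx ffunE !eqxx.
(* The new colour is the set [DD y] itself: if both ends of an edge have the same set and one port
   demands, the other is compatible with a type in it and accepts. *)
exists DD, (fun y i => (ty y i \in DD y, [exists u in DD y, compat u (ty y i)])).
split=> [y /DDP //|y i z j vy vz yz e /= tyD].
by apply/exists_inP; exists (ty y i); rewrite -?e //; apply: compat_ty.
Qed.

(** In radius 0 there is only one view, hence one colour. Some port demands, so all ports of the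
    other side, more than [K], would have to accept. *)
Lemma pview0_unsolvable (C : finType) K :
  (forall b, K < #|[set i | dir i == b]|) -> ~ solvable 0 C K.
Proof.
move=> big [col [st [cnt edge]]].
have [lt le] := cnt tt isT.
have /card_gt0P[i] : 0 < #|[set i | (st tt i).1]| by lia.
rewrite inE => Di.
have /subsetPn[j] : ~~ ([set j | dir j == ~~ dir i] \subset [set j | (st tt j).2]).
  by apply/negP => /subset_leq_card; have := big (~~ dir i); lia.
rewrite !inE => /eqP dj /negP[]; apply: (edge tt i tt j) => //=.
by rewrite dj; case: (dir i).
Qed.

(* The number of colours and the bound K after one round elimination. *)
Definition bounds_step (p : nat * nat) : nat * nat :=
  let m := 2 * 2 ^ (2 ^ (4 * p.1)) in
  (2 ^ m, m * gap_seq m (p.2.+1 * 2 ^ (4 * p.1)) m).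

Lemma card_label (C : finType) : #|label C| = 4 * #|C|.
Proof. by rewrite !card_prod !card_bool mulnC. Qed.

Lemma card_sets (T : finType) : #|{set T}| = 2 ^ #|T|.
Proof. by have := card_powerset [set: T]; rewrite powersetT !cardsT. Qed.

Lemma card_ptype (C : finType) : #|ptype C| = 2 * 2 ^ (2 ^ (4 * #|C|)).
Proof. by rewrite card_prod card_bool !card_sets card_label. Qed.

Lemma unsolvable_views t (C : finType) K :
  (forall b, (iter t bounds_step (#|C|, K)).2 < #|[set i | dir i == b]|) ->
  ~ solvable t C K.
Proof.
elim: t C K => [|t IH] C K big; first exact: pview0_unsolvable.
move/round_elimination; apply: IH => b; apply: leq_ltn_trans (big b).
by rewrite iterSr {2}/bounds_step /= /next_bound !card_sets !card_ptype !card_label.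
Qed.

(** One more round reveals the colours of the neighbours: the ports leading to the other colour
    demand, and no port accepts. *)
Lemma weak_coloring_solvable t (f : pview t -> bool) :
  (forall x : pview t.+1, pvalid x -> exists i, f (x.2 i).2 != f x.1) ->
  solvable t.+1 bool 0.
Proof.
move=> star; exists (fun x : pview t.+1 => f x.1),
  (fun (x : pview t.+1) i => (f (x.2 i).2 != f x.1, false)); split.
  move=> x vx /=; rewrite (eq_card0 (A := [set _ | false])) => [|i]; last by rewrite inE.
  by split=> //; have [i fi] := star x vx; apply/card_gt0P; exists i; rewrite inE.
move=> x i x' j _ _ /= /andP[/eqP e _]; rewrite e /= => ->.
by rewrite eqxx.
Qed.

(** The neighbour's view recorded in [x] is extended by [x.1] at the port leading back and by
    induction at its other ports. *)
Lemma padj_exists t (x : pview t) i :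
  (forall b, exists j, dir j = b) ->
  pvalid x -> exists p : P * pview t, pvalid p.2 && padj x i p.2 p.1.
Proof.
move=> dirs; elim: t x i => [|t IH] x i.
  by move=> _; have [j dj] := dirs (~~ dir i); exists (j, tt) => /=; rewrite dj; case: (dir i).
case/pvalidS=> vx h.
have [vz adj] := h i; move: vz adj; case e: (x.2 i) => [j z] /= vz adj.
have /fin_all_exists[s sP] : forall l, exists p : P * pview t,
    pvalid p.2 && padj z l p.2 p.1 /\ (l = j -> p = (i, x.1)).
  move=> l; have [->|lj] := eqVneq l j.
    by exists (i, x.1); rewrite /= vx padjC adj.
  by have [p pP] := IH z l vz; exists p; split=> // /eqP; rewrite (negbTE lj).
exists (j, (z, [ffun l => s l])); apply/andP; split.
  by apply/pvalidS; split=> // l; rewrite ffunE; have [/andP[]] := sP l.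
by rewrite /= e eqxx /= ffunE; have [_ ->] := sP j.
Qed.

End PortViews.

(** * Infinite port-numbered trees *)

Section Coherent.
Variables (P : finType) (dir : pred P).
Hypothesis dirs : forall b, exists j, dir j = b.
Local Notation pview := (pview P).
Local Notation pvalid := (@pvalid P dir _).

(* An infinite port-numbered tree, given by the views of its root at all radii. *)
Definition coherent (s : forall t, pview t) : Prop :=
  forall t, pvalid (s t) /\ (s t.+1).1 = s t.

(** The same tree rooted at the neighbour through port [i]; [bk] is the port through which that
    neighbour leads back. *)
Definition nb (s : forall t, pview t) (i : P) : forall t, pview t :=
  fun t => ((s t.+1).2 i).2.
Definition bk (s : forall t, pview t) (i : P) : P := ((s 1).2 i).1.

Section Neighbours.
Variable s : forall t, pview t.
Hypothesis coh : coherent s.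

Lemma coherent_adj t i (j := ((s t.+2).2 i).1) (z : pview t.+1 := ((s t.+2).2 i).2) :
  [/\ pvalid z, (s t.+1).2 i = (j, z.1) & z.2 j = (i, s t)].
Proof.
have [/pvalidS[_ /(_ i)[vz]]] := coh t.+2; rewrite (proj2 (coh t.+1)).
by case/andP=> /eqP e1 /eqP e2 _; split; rewrite // /z /j e2 (proj2 (coh t)).
Qed.

Lemma stepE t i : (s t.+1).2 i = (bk s i, nb s i t).
Proof.
rewrite /nb [LHS]surjective_pairing; congr pair.
elim: t => // t IH; have [_ e _] := coherent_adj t i.
by rewrite -IH e.
Qed.

Lemma coherent_nb i : coherent (nb s i).
Proof.
move=> t; split; first by have [/pvalidS[_ /(_ i)[]]] := coh t.+1.
by have [_ e _] := coherent_adj t i; rewrite /nb e.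
Qed.

Lemma nb_step t i : (nb s i t.+1).2 (bk s i) = (i, s t).
Proof. by have [_ _] := coherent_adj t i; rewrite (stepE t.+1). Qed.

Lemma bkK i : bk (nb s i) (bk s i) = i.
Proof. exact (congr1 (fun p : P * pview 0 => p.1) (nb_step 0 i)). Qed.

Lemma nbK i t : nb (nb s i) (bk s i) t = s t.
Proof. exact (congr1 (fun p : P * pview t => p.2) (nb_step t i)). Qed.

Lemma dir_bk i : dir i != dir (bk s i).
Proof. by have [/pvalidS[_ /(_ i)[_]]] := coh 1. Qed.

End Neighbours.

Definition prolong t (x : pview t) : pview t.+1 :=
  (x, [ffun i => odflt (i, x) [pick p | pvalid p.2 && padj dir x i p.2 p.1]]).

Lemma prolongP t (x : pview t) : pvalid x -> pvalid (prolong x) /\ (prolong x).1 = x.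
Proof.
move=> vx; split=> //; apply/pvalidS; split=> // i; rewrite /= ffunE.
case: pickP => [p /andP[]//|no].
by have [p] := padj_exists i dirs vx; rewrite no.
Qed.

(** The extension rule [e], changed at the single view [x.1] so that it yields [x]; the transport
    along [t = m] is due to the dependent type of views. *)
Definition patch t (x : pview t.+1) (e : forall m, pview m -> pview m.+1) m :
    pview m -> pview m.+1 :=
  match @eqP nat t m with
  | ReflectT E =>
      eq_rect t (fun m => pview m -> pview m.+1) (fun y => if y == x.1 then x else e t y) m E
  | ReflectF _ => e m
  end.

Fixpoint unroll (e : forall m, pview m -> pview m.+1) (m : nat) : pview m :=
  match m with 0 => tt | m'.+1 => e m' (unroll e m') end.

(** The tree is unrolled from an extension rule: the rule found for the truncation [x.1] is patched
    to continue with [x], and beyond [x] any valid extension will do. *)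
Lemma coherent_through t (x : pview t) : pvalid x -> exists2 s, coherent s & s t = x.
Proof.
move=> vx; suff [e eP ex] : exists2 e : forall m, pview m -> pview m.+1,
    (forall m y, pvalid y -> pvalid (e m y) /\ (e m y).1 = y) & unroll e t = x.
  exists (unroll e) => // m.
  have vm : pvalid (unroll e m) by elim: m => //= m IH; case: (eP m _ IH).
  by split=> //=; case: (eP m _ vm).
elim: t x vx => [|t IH] x vx; first by exists prolong => [m y /prolongP //|]; case: x vx.
have [vy _] := (pvalidS _ _).1 vx; have [e eP ex] := IH _ vy.
have pE m y : m != t -> patch x e y = e m y.
  by rewrite /patch => mt; case: eqP => // E; rewrite E eqxx in mt.
have pT : patch x e x.1 = x.
  by rewrite /patch; case: eqP => // E; rewrite (eq_irrelevance E erefl) /= eqxx.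
exists (patch x e).
  move=> m y vy'; rewrite /patch; case: eqP => [E|_]; last exact: eP.
  by subst m => /=; case: eqVneq => [->|_]; [split | exact: eP].
have uE m : m <= t -> unroll (patch x e) m = unroll e m.
  by elim: m => //= m IHm lt; rewrite IHm ?pE // 1?ltnW // ltn_eqF.
by rewrite /= uE // ex pT.
Qed.

End Coherent.

(** * Ping-pong on the line *)

Section PingPongOnTheLine.
Import GRing.Theory Num.Theory.
Local Open Scope ring_scope.

(** * Lifting maps of the circle to the line *)

Section CircleLift.

Definition frac (x : rat) : rat := x - (Num.floor x)%:~R.

Lemma frac_itv x : 0 <= frac x < 1.
Proof. by have := floor_itv x; rewrite intrD /frac; lra. Qed.

Lemma floor_frac (n : int) (t : rat) : 0 <= t < 1 ->
  Num.floor (n%:~R + t) = n /\ frac (n%:~R + t) = t.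
Proof.
move=> ht; have e : Num.floor (n%:~R + t) = n by apply: floor_def; rewrite intrD; lra.
by split=> //; rewrite /frac e; lra.
Qed.

Lemma frac_eq (n : int) (x t : rat) : x = n%:~R + t -> 0 <= t < 1 -> frac x = t.
Proof. by move=> -> /(floor_frac n)[]. Qed.

Lemma floorDfrac x : x = (Num.floor x)%:~R + frac x.
Proof. by rewrite /frac; lra. Qed.

Definition circle_lift (g : rat -> rat) (x : rat) : rat := (Num.floor x)%:~R + g (frac x).

Variable g : rat -> rat.
Hypothesis g_itv : forall t, 0 <= t < 1 -> 0 <= g t < 1.
Hypothesis g_mono : forall t u, 0 <= t -> t < u -> u < 1 -> g t < g u.

Lemma circle_lift_frac x : frac (circle_lift g x) = g (frac x).
Proof. by rewrite /circle_lift; case: (floor_frac (Num.floor x) (g_itv (frac_itv x))). Qed.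

Lemma circle_lift_lt x y : x < y -> circle_lift g x < circle_lift g y.
Proof.
move=> xy; rewrite /circle_lift.
have := g_itv (frac_itv x); have := g_itv (frac_itv y).
have /andP[x0 x1] := frac_itv x; have /andP[y0 y1] := frac_itv y.
have: (Num.floor x <= Num.floor y)%R by apply: le_floor; lra.
rewrite le_eqVlt => /orP[/eqP e|].
  rewrite e => _ _; have : frac x < frac y by rewrite /frac e; lra.
  by move=> /(g_mono x0)/(_ y1); lra.
by rewrite -lezD1 -(ler_int rat) intrD; lra.
Qed.

Lemma circle_lift_cancel (h : rat -> rat) :
  (forall t, 0 <= t < 1 -> h (g t) = t) -> cancel (circle_lift g) (circle_lift h).
Proof.
move=> gK x; rewrite {1}/circle_lift circle_lift_frac gK ?frac_itv //.
have [-> _] := floor_frac (Num.floor x) (g_itv (frac_itv x)).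
by rewrite -floorDfrac.
Qed.

End CircleLift.

(** * Two inverse piecewise linear maps of the unit interval *)

Section Contract.
Variables N I e : rat.
Hypotheses (N_ge1 : 1 <= N) (NV : N * I = 1) (e_gt0 : 0 < e) (Ne : N * e = 1 - e).

Let N_gt0 : 0 < N. Proof. exact: lt_le_trans ltr01 N_ge1. Qed.
Let NVe : (1 - e) * I = e. Proof. by rewrite -Ne mulrAC NV mul1r. Qed.
Let NV_gt0 : 0 < I. Proof. by rewrite -(pmulr_rgt0 _ N_gt0) NV. Qed.

(** The long arc [0, 1 - e) is squeezed by the factor [I], the inverse of [N], onto [0, e), and the
    short arc [1 - e, 1) is stretched by [N] onto [e, 1). The inverse map is [expand]. *)
Definition contract (t : rat) : rat := if t < 1 - e then t * I else e + N * (t - (1 - e)).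
Definition expand (t : rat) : rat := if t < e then t * N else 1 - e + (t - e) * I.

Local Ltac facts := move: N_ge1 N_gt0 e_gt0 Ne NV NVe NV_gt0 => ? ? ? ? ? ? ?.

Let e_lt1 : e <= 1 / 2.
Proof. by facts; have h : 0 <= (N - 1) * e by [apply: mulr_ge0; lra]; lra. Qed.

Lemma contract_itv t : 0 <= t < 1 -> 0 <= contract t < 1.
Proof.
facts; move=> ht; have eh := e_lt1; rewrite /contract; case: (ltP t (1 - e)) => h.
  have h1 : 0 <= t * I by apply: mulr_ge0; lra.
  have h2 : 0 < (1 - e - t) * I by apply: mulr_gt0; lra.
  lra.
have h1 : 0 <= N * (t - (1 - e)) by apply: mulr_ge0; lra.
have h2 : 0 < N * (1 - t) by apply: mulr_gt0; lra.
lra.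
Qed.

Lemma expand_itv t : 0 <= t < 1 -> 0 <= expand t < 1.
Proof.
facts; move=> ht; have eh := e_lt1; rewrite /expand; case: (ltP t e) => h.
  have h1 : 0 <= t * N by apply: mulr_ge0; lra.
  have h2 : 0 < (e - t) * N by apply: mulr_gt0; lra.
  lra.
have h1 : 0 <= (t - e) * I by apply: mulr_ge0; lra.
have h2 : 0 < (1 - t) * I by apply: mulr_gt0; lra.
lra.
Qed.

Lemma contract_lt t : contract t < e = (t < 1 - e).
Proof.
facts; rewrite /contract; case: (ltP t (1 - e)) => h; apply/idP.
  have h2 : 0 < (1 - e - t) * I by apply: mulr_gt0; lra.
  lra.
have h1 : 0 <= N * (t - (1 - e)) by apply: mulr_ge0; lra.
by apply/negP; rewrite -leNgt; lra.
Qed.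

Lemma expand_lt t : expand t < 1 - e = (t < e).
Proof.
facts; rewrite /expand; case: (ltP t e) => h; apply/idP.
  have h2 : 0 < (e - t) * N by apply: mulr_gt0; lra.
  lra.
have h1 : 0 <= (t - e) * I by apply: mulr_ge0; lra.
by apply/negP; rewrite -leNgt; lra.
Qed.

Lemma contractK t : expand (contract t) = t.
Proof.
facts; rewrite /expand contract_lt /contract; case: ltP => h; last first.
  have -> : e + N * (t - (1 - e)) - e = N * (t - (1 - e)) by rewrite addrAC subrr add0r.
  by rewrite mulrAC NV mul1r addrC subrK.
by rewrite -mulrA [I * _]mulrC NV mulr1.
Qed.

Lemma expandK t : contract (expand t) = t.
Proof.
facts; rewrite /contract expand_lt /expand; case: ltP => h; first by rewrite -mulrA NV mulr1.
have -> : 1 - e + (t - e) * I - (1 - e) = (t - e) * I by rewrite addrAC subrr add0r.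
by rewrite mulrCA NV mulr1 addrC subrK.
Qed.

Lemma contract_mono t u : t < u -> contract t < contract u.
Proof.
facts; move=> tu; rewrite /contract; case: (ltP t (1 - e)) => h; case: (ltP u (1 - e)) => h'.
- by rewrite ltr_pM2r.
- have h1 : 0 <= N * (u - (1 - e)) by apply: mulr_ge0; lra.
  have h2 : 0 < (1 - e - t) * I by apply: mulr_gt0; lra.
  lra.
- lra.
- by rewrite ltrD2l ltr_pM2l //; lra.
Qed.

Lemma expand_mono t u : t < u -> expand t < expand u.
Proof.
facts; move=> tu; rewrite ltNge; apply/negP; rewrite le_eqVlt => /orP[/eqP eq|/contract_mono].
  by have := congr1 contract eq; rewrite !expandK => eq'; move: tu; rewrite eq' ltxx.
by rewrite !expandK => /(lt_trans tu); rewrite ltxx.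
Qed.

End Contract.

(* Ping-pong on the line, lifted from the circle: the port i owns an arc
   [owned i], and crossing an edge from port i to port j maps the complement of
   [owned j] into [owned i]. *)
Section PingPong.
Variables (n : nat) (dir : pred 'I_n).
Hypothesis n_gt0 : (0 < n)%N.

Let N : rat := n%:R.
Let e : rat := (N + 1)^-1.

Let N_ge1 : 1 <= N. Proof. by rewrite ler1n. Qed.
Let NV : N * N^-1 = 1.
Proof. by rewrite mulfV // lt0r_neq0 // (lt_le_trans ltr01) // N_ge1. Qed.
Let e_gt0 : 0 < e. Proof. by rewrite invr_gt0; have := N_ge1; lra. Qed.
Let Ne : N * e = 1 - e.
Proof.
have h : (N + 1) * e = 1.
  by rewrite mulfV // lt0r_neq0 //; have := N_ge1; lra.
by rewrite mulrDl mul1r in h; rewrite -h addrK.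
Qed.

(** The circle consists of n + 1 arcs of length [e]: one for each port and a last one, starting at
    [origin], that no port owns. *)
Definition origin : rat := 1 - e.
Definition owned (i : 'I_n) (x : rat) : bool := frac (x - i%:R * e) < e.
(** If [dir i] holds, the complement of the arc of [j] is rotated to [0, 1 - e) and contracted into
    the arc of [i]. The other case is the inverse formula, so that crossing back undoes crossing. *)
Definition cross (i j : 'I_n) (x : rat) : rat :=
  if dir i then i%:R * e + circle_lift (contract N N^-1 e) (x - j%:R * e - e)
  else i%:R * e + e + circle_lift (expand N N^-1 e) (x - j%:R * e).

Let cI := contract_itv N_ge1 NV e_gt0 Ne.
Let eI := expand_itv N_ge1 NV e_gt0 Ne.
Let cM (t u : rat) (_ : 0 <= t) tu (_ : u < 1) := contract_mono N_ge1 NV e_gt0 Ne (t := t) (u := u) tu.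
Let eM (t u : rat) (_ : 0 <= t) tu (_ : u < 1) := expand_mono N_ge1 NV e_gt0 Ne (t := t) (u := u) tu.

Lemma cross_lt i j : {homo cross i j : x y / x < y}.
Proof.
move=> x y xy; rewrite /cross; case: ifP => _; rewrite ltrD2l.
  by apply: (circle_lift_lt cI cM); lra.
by apply: (circle_lift_lt eI eM); lra.
Qed.

Lemma crossK i j : dir i != dir j -> cancel (cross i j) (cross j i).
Proof.
move=> dij x; rewrite /cross; case: (dir i) (dir j) dij => -[] // _.
  rewrite [X in circle_lift (expand _ _ _) X](_ : _ = circle_lift (contract N N^-1 e) (x - j%:R * e - e)); last by lra.
  rewrite (circle_lift_cancel cI) => [|t _]; last exact: contractK N_ge1 NV e_gt0 Ne _.
  by lra.
rewrite [X in circle_lift (contract _ _ _) X](_ : _ = circle_lift (expand N N^-1 e) (x - j%:R * e)); last by lra.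
rewrite (circle_lift_cancel eI) => [|t _]; last exact: expandK N_ge1 NV e_gt0 Ne _.
by lra.
Qed.

Let e_le_half : e <= 1 / 2.
Proof. by have := N_ge1; have := Ne; have := e_gt0; nra. Qed.

Lemma cross_owned i j x : ~~ owned j x -> owned i (cross i j x).
Proof.
rewrite /owned -leNgt => h; have fI := frac_itv (x - j%:R * e).
have e0 := e_gt0; have eh := e_le_half.
rewrite /cross; case: ifP => _.
  rewrite [X in frac X](_ : _ = circle_lift (contract N N^-1 e) (x - j%:R * e - e)); last by lra.
  rewrite (circle_lift_frac cI) (contract_lt N_ge1 NV e_gt0 Ne).
  rewrite (frac_eq (n := Num.floor (x - j%:R * e)) (t := frac (x - j%:R * e) - e)); first by lra.
    by rewrite {1}(floorDfrac (x - j%:R * e)); lra.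
  by lra.
have gI := eI fI.
have g1 : 1 - e <= expand N N^-1 e (frac (x - j%:R * e)).
  by rewrite leNgt (expand_lt N_ge1 NV e_gt0 Ne) -leNgt.
rewrite (frac_eq (n := Num.floor (x - j%:R * e) + 1) (t := expand N N^-1 e (frac (x - j%:R * e)) - (1 - e))).
- rewrite /expand [_ < e as X in if X then _ else _]ltNge h /=.
  have : 0 < (1 - frac (x - j%:R * e)) * N^-1.
    by apply: mulr_gt0; rewrite ?invr_gt0; have := N_ge1; lra.
  have NVe : (1 - e) * N^-1 = e.
    by rewrite -Ne mulrAC mulfV ?mul1r // lt0r_neq0 //; have := N_ge1; lra.
  by lra.
- by rewrite /circle_lift intrD; lra.
- by lra.
Qed.

Lemma owned_inj i j x : owned i x -> owned j x -> i = j.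
Proof.
wlog le_ij : i j / (i <= j)%N.
  by move=> W; case: (leqP i j) => [/W //|/ltnW/W h ? ?]; apply/esym/h.
rewrite /owned => hi hj; apply: val_inj => /=; apply/eqP; rewrite eqn_leq le_ij /= leqNgt.
apply/negP => lt_ij.
have e0 := e_gt0; have := Ne.
have /andP[ai _] := frac_itv (x - i%:R * e); have /andP[aj _] := frac_itv (x - j%:R * e).
have Ei := floorDfrac (x - i%:R * e); have Ej := floorDfrac (x - j%:R * e).
set A := Num.floor _ in Ei; set B := Num.floor _ in Ej => NE.
have ijN : j%:R < N :> rat by rewrite ltr_nat.
have ij1 : i%:R + 1 <= j%:R :> rat by rewrite natr1 ler_nat.
have i0 : 0 <= i%:R :> rat by [].
have h1 : e <= (j%:R - i%:R) * e by have := ler_wpM2r (ltW e0) ij1; lra.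
have h2 : (j%:R - i%:R) * e < 1 - e.
  by have := ltr_pM2r e0 j%:R N; rewrite ijN NE => h; have := mulr_ge0 i0 (ltW e0); lra.
have c1 : (B%:~R : rat) < (A : int)%:~R + 0 + 1 by lra.
have c2 : (A%:~R : rat) < (B : int)%:~R + 1 by lra.
have AB : A = B.
  apply/eqP; rewrite eq_le -!ltzD1 -!(ltr_int rat) !intrD; lra.
rewrite AB in Ei; lra.
Qed.

Lemma origin_not_owned i : ~~ owned i origin.
Proof.
have e0 := e_gt0; have eh := e_le_half; have i0 : 0 <= i%:R * e by rewrite mulr_ge0 // ltW.
have h : (i%:R + 1) * e <= N * e.
  by apply: ler_wpM2r; [exact: ltW | rewrite natr1 ler_nat].
have := Ne; rewrite /owned -leNgt /origin => NE.
by rewrite (frac_eq (n := 0) (t := 1 - e - i%:R * e)); lra.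
Qed.

End PingPong.

End PingPongOnTheLine.

(** * Trees as input graphs *)

Section Balls.
Variables (V : finType) (E : rel V).

Lemma ball_self T v : v \in ball E T v.
Proof. by elim: T => [|T IH] /=; [rewrite set11 | rewrite in_setU IH]. Qed.

(** This unrolls the ball at its centre, as port views are built, whereas [ball] grows at the
    boundary. *)
Lemma ball_step T v u :
  (u \in ball E T.+1 v) = (u == v) || [exists w, E v w && (u \in ball E T w)].
Proof.
elim: T u => [|T IH] u.
  rewrite /= !inE; congr orb; apply/existsP/existsP => -[w].
    by rewrite inE => /andP[/eqP-> Evu]; exists u; rewrite Evu inE eqxx.
  by rewrite inE => /andP[Evw /eqP->]; exists v; rewrite inE eqxx.
rewrite [ball _ _ _]/= in_setU inE; apply/orP/orP.
- case=> [|/existsP[w /andP[]]].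
    rewrite IH => /orP[->|/existsP[w /andP[Evw uw]]]; first by left.
    by right; apply/existsP; exists w; rewrite Evw /= inE uw.
  rewrite IH => /orP[/eqP-> Evu|/existsP[x /andP[Evx wx]] Ewu].
    by right; apply/existsP; exists u; rewrite Evu ball_self.
  right; apply/existsP; exists x; rewrite Evx /= !inE; apply/orP; right.
  by apply/existsP; exists w; rewrite wx.
- case=> [/eqP->|/existsP[w /andP[Evw]]].
    by left; rewrite IH eqxx.
  rewrite /= in_setU => /orP[uw|].
    by left; rewrite IH; apply/orP; right; apply/existsP; exists w; rewrite Evw.
  rewrite inE => /existsP[x /andP[xw Exu]]; right; apply/existsP; exists x.
  by rewrite Exu IH andbT; apply/orP; right; apply/existsP; exists w; rewrite Evw.
Qed.

Lemma ballS T v : ball E T v \subset ball E T.+1 v.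
Proof. exact: subsetUl. Qed.

Hypothesis symE : symmetric E.
Variable c : V -> bool.
Hypothesis bip : forall u v, E u v -> c u != c v.

Lemma ball_parity T v u :
  u \in ball E T.+1 v -> u \in ball E T v \/ c u = c v (+) odd T.+1.
Proof.
elim: T u => [|T IH] u.
  rewrite /= !inE => /orP[->|/existsP[w]]; first by left.
  by rewrite inE => /andP[/eqP-> /bip cvu]; right; move: cvu; case: (c u) (c v) => -[].
rewrite [in X in X -> _]/= in_setU inE => /orP[->|/existsP[w /andP[wB Ewu]]]; first by left.
case: (IH w wB) => [wT|cw].
  by left; rewrite /= in_setU inE; apply/orP; right; apply/existsP; exists w; rewrite wT.
right; have := bip Ewu; rewrite cw /=; by case: (c u) (c v) (odd T) => -[] [].
Qed.

(** Nodes at distance exactly T + 1 have equal parity and so are not adjacent. Hence an induced ball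
    has just the edges that a port view of the same radius records. *)
Lemma ball_edges T v u w : E u w ->
  (u \in ball E T.+1 v) && (w \in ball E T.+1 v) <-> u \in ball E T v \/ w \in ball E T v.
Proof.
move=> Euw; split=> [/andP[/ball_parity[uB|cu] /ball_parity[wB|cw]]|]; auto.
  by have := bip Euw; rewrite cu cw eqxx.
have step x y : E x y -> x \in ball E T v -> y \in ball E T.+1 v.
  move=> Exy xT; rewrite /= in_setU inE; apply/orP; right.
  by apply/existsP; exists x; rewrite xT.
case=> xT; apply/andP; split; try exact: (subsetP (ballS _ _)) xT.
  exact: step Euw xT.
by apply: step xT; rewrite symE.
Qed.

End Balls.

Section Tree.
Variables n L : nat.
Hypothesis L_gt0 : 0 < L.
Local Notation P := 'I_n.+1.

(* In a node other than the root the letter 0 stands for the parent. *)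
Definition tnode : finType := {w : {bseq L of P} | all (predC1 ord0) (behead w)}.
Definition wd (v : tnode) : seq P := val v.
Definition par : rel tnode := fun u v => [exists c, wd v == rcons (wd u) c].
Definition tree : rel tnode := fun u v => par u v || par v u.

Lemma wd_inj : injective wd. Proof. by move=> u v e; do 2!apply: val_inj. Qed.

Lemma wd_size v : size (wd v) <= L. Proof. exact: size_bseq. Qed.

Lemma wd_all v : all (predC1 ord0) (behead (wd v)). Proof. exact: (valP v). Qed.

Lemma wd_exists (w : seq P) :
  size w <= L -> all (predC1 ord0) (behead w) -> exists v, wd v = w.
Proof. by move=> sw aw; exists (exist _ (Bseq sw) aw). Qed.

Definition troot : tnode := exist _ (Bseq (isT : size [::] <= L)) isT.

Lemma parP u v : reflect (exists c, wd v = rcons (wd u) c) (par u v).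
Proof. by apply: (iffP existsP) => -[c h]; exists c; apply/eqP. Qed.

Lemma par_size u v : par u v -> size (wd v) = (size (wd u)).+1.
Proof. by case/parP=> c ->; rewrite size_rcons. Qed.

Lemma tree_sym : symmetric tree. Proof. by move=> u v; rewrite /tree orbC. Qed.

Lemma tree_bip u v : tree u v -> odd (size (wd u)) != odd (size (wd v)).
Proof. by case/orP=> /par_size -> /=; case: odd. Qed.

Lemma tree_simple : simple_graph tree.
Proof. by split=> [|u]; [exact: tree_sym | apply/negP => /tree_bip; rewrite eqxx]. Qed.

Lemma has_parent v : v != troot -> exists u, par u v.
Proof.
move=> vr; have : wd v != [::].
  by apply: contra vr => /eqP e; apply/eqP/wd_inj.
case/lastP E: (wd v) => [//|w c] _.
have [||u uE] := @wd_exists w; first by have := wd_size v; rewrite E size_rcons => /ltnW.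
  have := wd_all v; rewrite E; case: (w) => //= a w'.
  by rewrite all_rcons => /andP[].
by exists u; apply/parP; exists c; rewrite E uE.
Qed.

Lemma tree_connected : connected_graph tree.
Proof.
have to_root v : connect tree v troot.
  have [k] := ubnP (size (wd v)); elim: k v => // k IH v lt.
  have [->|/has_parent[u puv]] := eqVneq v troot; first exact: connect0.
  apply: connect_trans (connect1 _) (IH u _); first by rewrite /tree puv orbT.
  by rewrite (par_size puv) in lt.
move=> u v; apply: connect_trans (to_root u) _.
by rewrite (sym_connect_sym tree_sym).
Qed.

Lemma leaf_deg v : size (wd v) = L -> deg tree v = 1.
Proof.
move=> sv; have [|u pu] := @has_parent v.
  by apply: contraTneq L_gt0 => e; rewrite -sv e.
rewrite /deg; suff -> : [set w | tree v w] = [set u] by rewrite cards1.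
apply/setP=> w; rewrite !inE; apply/idP/eqP => [/orP[/par_size e|]|->]; last by rewrite /tree pu orbT.
  by have := wd_size w; rewrite e sv ltnn.
case/parP: pu => c e /parP[c' e']; apply: wd_inj.
by move: e; rewrite e' => /rcons_inj[].
Qed.

(** Deep trees have enough nodes, and thus enough identifiers, for Ramsey's theorem. *)
Lemma tree_card : 0 < n -> L <= #|tnode|.
Proof.
move=> n0; have /fin_all_exists[g gE] : forall k : 'I_L, exists v, wd v = nseq k ord_max.
  move=> k; apply: wd_exists; first by rewrite size_nseq ltnW.
  apply/allP => c /mem_behead/nseqP[-> _] /=.
  by rewrite -val_eqE /= -lt0n.
rewrite -[L]card_ord; apply: (leq_card g) => k l e; apply: val_inj => /=.
by have := congr1 wd e; rewrite !gE => /(congr1 size); rewrite !size_nseq.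
Qed.

End Tree.

(** * Points of a port-numbered tree *)

Section Points.
Variable n : nat.
Local Notation P := 'I_n.+1.
Local Notation state := (forall t, pview P t).
Variable dir : pred P.
Local Notation o := (origin n.+1).
Local Notation cross := (cross dir).

(** The positions of the nodes of the ball, in coordinates that put its centre at [origin]. Walks
    that turn back produce repetitions. *)
Fixpoint pts (t : nat) : pview P t -> seq rat :=
  match t with
  | 0 => fun _ => [:: o]
  | t'.+1 => fun x => o :: flatten [seq map (cross i (x.2 i).1) (pts (x.2 i).2) | i : P]
  end.

Definition map_pair (f : rat -> rat) (e : rat * rat) : rat * rat := (f e.1, f e.2).

Fixpoint edg (t : nat) : pview P t -> seq (rat * rat) :=
  match t with
  | 0 => fun _ => [::]
  | t'.+1 => fun x => flatten
      [seq let q := cross i (x.2 i).1 o in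
           (o, q) :: (q, o) :: map (map_pair (cross i (x.2 i).1)) (edg (x.2 i).2) | i : P]
  end.

Lemma cross_homo i j : {homo cross i j : x y / (x < y)%R}.
Proof. exact: cross_lt. Qed.

Lemma lt_homo_inj (f : rat -> rat) : {homo f : x y / (x < y)%R} -> injective f.
Proof.
by move=> fh x y e; case: (ltgtP x y) => // /fh; rewrite e ltxx.
Qed.

Lemma cross_inj i j : injective (cross i j).
Proof. exact: lt_homo_inj (@cross_homo i j). Qed.

Lemma origin_pts t (x : pview P t) : o \in pts x.
Proof. by case: t x => [|t] x; rewrite inE eqxx. Qed.

Lemma edg_pts t (x : pview P t) e : e \in edg x -> e.1 \in pts x /\ e.2 \in pts x.
Proof.
elim: t x e => // t IH x e /flattenP[_ /mapP[i _ ->]].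
set q := cross i _ o.
have sub r : r \in pts (x.2 i).2 -> cross i (x.2 i).1 r \in pts x.
  move=> rz; rewrite inE; apply/orP; right; apply/flattenP.
  exists (map (cross i (x.2 i).1) (pts (x.2 i).2)); last exact: map_f.
  by apply: map_f; rewrite mem_enum.
have qx : q \in pts x by apply: sub; apply: origin_pts.
move: (pts x) (origin_pts x) sub qx => px ox sub qx.
rewrite !inE => /or3P[/eqP->|/eqP->|/mapP[e' /IH[h1 h2] ->]]; rewrite /map_pair /=; split=> //; exact: sub.
Qed.

(* [port_of e c] is the port of letter c at a node entered through port e; it
   sends the letter 0 of the parent to e. *)
Definition port_of (e c : P) : P := tperm ord0 e c.

(** A walk along [w] from a node entered through [e]: [wst] is the tree seen at its end, [went] the
    port of arrival, [wfr] the change of coordinates from the end to the start. *)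
Fixpoint wst (s : state) (e : P) (w : seq P) : state :=
  if w is c :: w' then let i := port_of e c in wst (nb s i) (bk s i) w' else s.
Fixpoint went (s : state) (e : P) (w : seq P) : P :=
  if w is c :: w' then let i := port_of e c in went (nb s i) (bk s i) w' else e.
Fixpoint wfr (s : state) (e : P) (w : seq P) : rat -> rat :=
  if w is c :: w' then let i := port_of e c in
    fun x => cross i (bk s i) (wfr (nb s i) (bk s i) w' x)
  else id.

Lemma wst_rcons s e w c : wst s e (rcons w c) = nb (wst s e w) (port_of (went s e w) c).
Proof. by elim: w s e => //= a w IH s e. Qed.

Lemma went_rcons s e w c : went s e (rcons w c) = bk (wst s e w) (port_of (went s e w) c).
Proof. by elim: w s e => //= a w IH s e. Qed.

Lemma wfr_rcons s e w c x : wfr s e (rcons w c) x =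
  wfr s e w (cross (port_of (went s e w) c) (bk (wst s e w) (port_of (went s e w) c)) x).
Proof. by elim: w s e => //= a w IH s e; rewrite IH. Qed.

Lemma wfr_homo s e w : {homo wfr s e w : x y / (x < y)%R}.
Proof. by elim: w s e => [|c w IH] s e x y xy //=; apply/cross_homo/IH. Qed.

Lemma wst_coherent s e w : coherent dir s -> coherent dir (wst s e w).
Proof. by elim: w s e => [|c w IH] s e cs //=; apply/IH/coherent_nb. Qed.

(** Ping-pong: the next letter is not 0, so the walk does not turn back, the rest of it ends outside
    the arc of the return port, and crossing moves that point into the arc of the first port. *)
Lemma wfr_owned s e c w : all (predC1 ord0) w -> owned (port_of e c) (wfr s e (c :: w) o).
Proof.
elim: w c s e => [|a w IH] c s e.
  by move=> _; apply/cross_owned/origin_not_owned.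
case/andP=> /= a0 aw; apply: cross_owned => //.
have h := IH a (nb s (port_of e c)) (bk s (port_of e c)) aw.
apply: contra a0 => h'; have := owned_inj (ltn0Sn n) h h'.
rewrite /port_of => h2; apply/eqP; apply: (@perm_inj _ (tperm ord0 (bk s (tperm ord0 e c)))).
by rewrite h2 tpermL.
Qed.

(** The arc containing the point reveals the first letter, and lying in no arc reveals the empty
    word; crossings are injective, so induction applies to the rest. *)
Lemma wfr_inj s e w w' : all (predC1 ord0) (behead w) -> all (predC1 ord0) (behead w') ->
  wfr s e w o = wfr s e w' o -> w = w'.
Proof.
elim: w w' s e => [|c w IH] [|c' w'] s e //=.
- move=> _ aw' e0; have := wfr_owned s e c' aw'.
  by rewrite /= -e0 (negbTE (origin_not_owned _ _)).
- move=> aw _ e0; have := wfr_owned s e c aw.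
  by rewrite /= e0 (negbTE (origin_not_owned _ _)).
move=> aw aw' e0; have h := wfr_owned s e c aw; have h' := wfr_owned s e c' aw'.
rewrite /= e0 in h; have cc := owned_inj (ltn0Sn n) h h'.
have ec : c = c' by exact: perm_inj cc.
subst c'; congr cons; move/cross_inj: e0; apply: IH.
  by case: (w) aw => //= ? ? /andP[].
by case: (w') aw' => //= ? ? /andP[].
Qed.

Variable L : nat.
Variable s : state.
Hypothesis coh : coherent dir s.
Local Notation tnode := (tnode n L).
Local Notation tree := (@tree n L).

Definition st (v : tnode) : state := wst s ord0 (wd v).
Definition fr (v : tnode) : rat -> rat := wfr s ord0 (wd v).
Definition pt (v : tnode) : rat := fr v o.

Lemma pt_inj : injective pt.
Proof. by move=> u v /wfr_inj e; apply: wd_inj; apply: e; apply: wd_all. Qed.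

Lemma st_coherent v : coherent dir (st v). Proof. exact: wst_coherent. Qed.

(** This covers children and parents alike; views and coordinates, being functions, are compared
    pointwise. *)
Definition nbr_at (v : tnode) (i : P) (u : tnode) : Prop :=
  [/\ tree v u, forall t, st u t = nb (st v) i t &
      forall x, fr u x = fr v (cross i (bk (st v) i) x)].

Lemma nbr_child u v c : wd v = rcons (wd u) c ->
  nbr_at u (port_of (went s ord0 (wd u)) c) v.
Proof.
move=> e; split; first by apply/orP; left; apply/parP; exists c.
  by move=> t; rewrite /st e wst_rcons.
by move=> x; rewrite /fr e wfr_rcons.
Qed.

Lemma nbr_parent u v c : wd v = rcons (wd u) c -> nbr_at v (went s ord0 (wd v)) u.
Proof.
move=> e; have cu := st_coherent u; pose i := port_of (went s ord0 (wd u)) c.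
have sv : st v = nb (st u) i by rewrite /st e wst_rcons.
have ev : went s ord0 (wd v) = bk (st u) i by rewrite e went_rcons.
split; first by apply/orP; right; apply/parP; exists c.
  by move=> t; rewrite ev sv (nbK cu).
move=> x; rewrite ev sv (bkK cu) {2}/fr e wfr_rcons -/(st u) -/i crossK //.
by rewrite eq_sym; apply: dir_bk.
Qed.

Lemma nbr_at_of v u : tree v u -> exists i, nbr_at v i u.
Proof.
case/orP=> /parP[c e]; first by eexists; apply: nbr_child e.
by eexists; apply: nbr_parent e.
Qed.

Lemma nbr_at_exists v i : size (wd v) < L -> exists u, nbr_at v i u.
Proof.
move=> sv; pose c := port_of (went s ord0 (wd v)) i.
have ic : i = port_of (went s ord0 (wd v)) c by rewrite /c /port_of tpermK.
have [vr|vr] := eqVneq v (troot n L).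
  have [||u uE] := @wd_exists n L [:: c] => //; first by rewrite vr in sv.
  by exists u; rewrite ic; apply: nbr_child; rewrite uE vr.
have [c0|c0] := eqVneq c ord0.
  have [u /parP[a e]] := has_parent vr.
  by exists u; rewrite ic c0 /port_of tpermL; apply: nbr_parent e.
have [||u uE] := @wd_exists n L (rcons (wd v) c); first by rewrite size_rcons.
  have : wd v != [::] by apply: contra vr => /eqP e; apply/eqP/wd_inj.
  have := wd_all v; case: (wd v) => //= a w aw _.
  by rewrite all_rcons aw /= c0.
by exists u; rewrite ic; apply: nbr_child.
Qed.

(** Different ports lead to different neighbours, because in the coordinates of [v] the neighbour
    through port [i] lies in the arc of [i]. *)
Lemma inner_deg v : size (wd v) < L -> deg tree v = n.+1.
Proof.
move=> sv; have /fin_all_exists[g gP] : forall i, exists u, nbr_at v i u.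
  by move=> i; apply: nbr_at_exists.
have g_inj : injective g.
  move=> i j e; have [_ _ fi] := gP i; have [_ _ fj] := gP j.
  have := fi o; rewrite e fj => /(lt_homo_inj (@wfr_homo _ _ _)) eij.
  have own k l : owned k (cross k l o) by apply/cross_owned/origin_not_owned.
  by apply: (owned_inj (ltn0Sn n) (own i (bk (st v) i))); rewrite -eij; apply: own.
rewrite -[n.+1]card_ord -(card_codom g_inj) /deg; apply: eq_card => u; rewrite inE.
apply/idP/codomP => [/nbr_at_of[i [tvu su fu]]|[i ->]]; last by case: (gP i).
exists i; apply: pt_inj; have [_ _ fi] := gP i.
by rewrite /pt fu fi.
Qed.

(** The bound on [size (wd v) + T] keeps nodes at distance below [T] from being leaves, so the ball
    is that of the infinite tree, and both sides unroll at the centre. *)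
Lemma ball_pts T v r : size (wd v) + T <= L ->
  reflect (exists2 u, u \in ball tree T v & pt u = r) (r \in map (fr v) (pts (st v T))).
Proof.
elim: T v r => [|T IH] v r le.
  rewrite /= inE; apply: (iffP eqP) => [->|[u /set1P-> //]].
  by exists v; rewrite ?set11.
have sv : size (wd v) < L by lia.
have szu u : tree v u -> size (wd u) <= (size (wd v)).+1.
  by case/orP=> /par_size; lia.
apply: (iffP mapP) => [[x]|[u]].
  rewrite inE => /orP[/eqP-> ->|/flattenP[_ /mapP[i _ ->] /mapP[y yi ->]] ->].
    by exists v; rewrite ?ball_self.
  have [u [tvu su fu]] := nbr_at_exists i sv.
  move: yi; rewrite (stepE (st_coherent v)) /= -su => yi.
  have leu : size (wd u) + T <= L by have := szu u tvu; lia.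
  have /(IH _ _ leu)[w wu pw] : fr u y \in map (fr u) (pts (st u T)) by apply: map_f.
  exists w; last by rewrite pw fu.
  by rewrite ball_step; apply/orP; right; apply/existsP; exists u; rewrite tvu.
rewrite ball_step => /orP[/eqP-> <-|/existsP[w /andP[tvw uw]] <-].
  by exists o; rewrite // inE eqxx.
have [i [_ sw fw]] := nbr_at_of tvw.
have /mapP[y yw ->] : pt u \in map (fr w) (pts (st w T)).
  by apply/IH; [have := szu w tvw; lia | exists u].
exists (cross i (bk (st v) i) y); last by rewrite fw.
rewrite inE; apply/orP; right; apply/flattenP.
exists (map (cross i ((st v T.+1).2 i).1) (pts ((st v T.+1).2 i).2)).
  by apply: map_f; rewrite mem_enum.
by rewrite (stepE (st_coherent v)) /= -sw; apply: map_f.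
Qed.

Lemma ball_edg T v e : size (wd v) + T <= L ->
  reflect (exists u w, [/\ tree u w, u \in ball tree T v, w \in ball tree T v & e = (pt u, pt w)])
    (e \in map (map_pair (fr v)) (edg (st v T))).
Proof.
elim: T v e => [|T IH] v e le.
  apply: (iffP idP) => // -[u [w [tuw /set1P uv /set1P wv _]]].
  by move: (tree_bip tuw); rewrite uv wv eqxx.
have edges := ball_edges (@tree_sym n L) (@tree_bip n L) T v.
have sv : size (wd v) < L by lia.
have szu u : tree v u -> size (wd u) <= (size (wd v)).+1.
  by case/orP=> /par_size; lia.
have nbP u T' : tree v u -> ball tree T' u \subset ball tree T'.+1 v.
  move=> tvu; apply/subsetP=> w wu; rewrite ball_step; apply/orP; right.
  by apply/existsP; exists u; rewrite tvu.
apply: (iffP mapP) => [[x]|[u [w [tuw uB wB ->]]]].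
  move=> /flattenP[_ /mapP[i _ ->]].
  have [u [tvu su fu]] := nbr_at_exists i sv.
  rewrite (stepE (st_coherent v)) /= -su !inE.
  have uB : u \in ball tree T.+1 v by apply: (subsetP (nbP u T tvu)); apply: ball_self.
  have vB := ball_self tree T.+1 v.
  have fo : fr v (cross i (bk (st v) i) o) = pt u by rewrite -fu.
  case/or3P=> [/eqP->|/eqP->|/mapP[y yu ->]] ->; rewrite /map_pair /= ?fo.
  - by exists v, u.
  - by exists u, v; rewrite tree_sym.
  have leu : size (wd u) + T <= L by have := szu u tvu; lia.
  have /(IH _ _ leu)[a [b [tab aB bB yE]]] : map_pair (fr u) y \in map (map_pair (fr u)) (edg (st u T)).
    exact: map_f.
  exists a, b; split=> //; try exact: (subsetP (nbP u T tvu)).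
  by rewrite -yE /map_pair !fu.
pose block i z : seq (rat * rat) := (o, cross i (bk (st v) i) o) :: (cross i (bk (st v) i) o, o) ::
  map (map_pair (cross i (bk (st v) i))) (edg (st z T)).
have mem_block i z x : nbr_at v i z -> x \in block i z -> x \in edg (st v T.+1).
  case=> _ sz _ xin; apply/flattenP; exists (block i z) => //.
  by apply/mapP; exists i; rewrite ?mem_enum // (stepE (st_coherent v)) /= -sz.
(* An edge with an end in the ball of radius [T] either starts at [v] or lies inside the ball of
   radius [T] of a neighbour [z]. *)
have near_edge a b : tree a b -> a \in ball tree T v -> exists i z, nbr_at v i z /\
    forall a' b', (a', b') \in [:: (a, b); (b, a)] ->
      exists2 x, x \in block i z & (pt a', pt b') = map_pair (fr v) x.
  move=> tab aT; have [av|av] := eqVneq a v.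
    rewrite av in tab *; have [i nb_i] := nbr_at_of tab; have [_ _ fb] := nb_i.
    exists i, b; split=> // a' b'; rewrite !inE => /orP[] /eqP[-> ->].
      by exists (o, cross i (bk (st v) i) o); rewrite ?inE ?eqxx // /map_pair /= -fb.
    by exists (cross i (bk (st v) i) o, o); rewrite ?inE ?eqxx ?orbT // /map_pair /= -fb.
  have [z tvz /andP[aB bB]] : exists2 z, tree v z & (a \in ball tree T z) && (b \in ball tree T z).
    case: (T) aT => [/set1P av'|T']; first by rewrite av' eqxx in av.
    rewrite ball_step (negbTE av) => /existsP[z /andP[tvz az]]; exists z => //.
    by apply/(ball_edges (@tree_sym n L) (@tree_bip n L) T' z tab); left.
  have [i nb_i] := nbr_at_of tvz; have [_ _ fz] := nb_i.
  have lez : size (wd z) + T <= L by have := szu z tvz; lia.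
  exists i, z; split=> // a' b' ab'.
  have /mapP[y yz yE] : (pt a', pt b') \in map (map_pair (fr z)) (edg (st z T)).
    apply/(IH _ _ lez); exists a', b'; move: ab'.
    by rewrite !inE => /orP[] /eqP[-> ->]; rewrite // tree_sym.
  exists (map_pair (cross i (bk (st v) i)) y); last by rewrite yE /map_pair /= !fz.
  by rewrite !inE (map_f _ yz) !orbT.
have [uT|wT] := (edges u w tuw).1 (introT andP (conj uB wB)).
  have [i [z [nz /(_ u w)]]] := near_edge u w tuw uT.
  by case=> [|x xin ->]; [rewrite !inE eqxx | exists x; rewrite ?(mem_block i z)].
have twu : tree w u by rewrite tree_sym.
have [i [z [nz /(_ u w)]]] := near_edge w u twu wT.
by case=> [|x xin ->]; [rewrite !inE eqxx orbT | exists x; rewrite ?(mem_block i z)].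
Qed.

End Points.

(** * From local algorithms to port-numbered views *)

(** The nodes are listed with [B] first, the numbers below [#|V|] with the values of [g] first, and
    the two lists are matched by position. *)
Lemma injection_extension (V : finType) (B : {set V}) (g : V -> nat) :
  {in B &, injective g} -> {in B, forall v, g v < #|V|} ->
  exists idf : V -> nat,
    [/\ injective idf, forall v, idf v < #|V| & {in B, idf =1 g}].
Proof.
move=> gi gV; pose l1 := enum B ++ enum (~: B).
pose im := map g (enum B); pose l2 := im ++ [seq k <- iota 0 #|V| | k \notin im].
have memB v : (v \in enum B) = (v \in B) by rewrite mem_enum.
have ul1 : uniq l1.
  rewrite cat_uniq !enum_uniq andbT /=; apply/hasPn => v.
  by rewrite !mem_enum in_setC.
have l1T v : v \in l1 by rewrite mem_cat !mem_enum in_setC orbN.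
have uim : uniq im.
  by rewrite map_inj_in_uniq ?enum_uniq // => u v; rewrite !memB; apply: gi.
have ul2 : uniq l2.
  rewrite cat_uniq uim filter_uniq ?iota_uniq // andbT; apply/hasPn => k.
  by rewrite mem_filter => /andP[].
have l2V k : (k \in l2) = (k < #|V|).
  rewrite mem_cat mem_filter mem_iota add0n /=; case: (boolP (k \in im)) => //=.
  by case/mapP=> v; rewrite memB => vB ->; rewrite gV.
have sl1 : size l1 = #|V|.
  by rewrite cardT; apply/perm_size/uniq_perm; rewrite ?enum_uniq // => v; rewrite l1T mem_enum.
have sl2 : size l2 = #|V|.
  rewrite -[RHS](size_iota 0); apply/perm_size/uniq_perm; rewrite ?iota_uniq // => k.
  by rewrite l2V mem_iota.
have ltl v : index v l1 < size l2 by rewrite sl2 -sl1 index_mem.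
exists (fun v => nth 0 l2 (index v l1)); split.
- move=> u v /eqP; rewrite nth_uniq ?ltl // => /eqP e.
  by rewrite -(nth_index u (l1T u)) e nth_index.
- by move=> v; rewrite -l2V mem_nth.
- move=> v vB /=; have vE : v \in enum B by rewrite memB.
  rewrite /l1 index_cat vE nth_cat size_map index_mem vE.
  by rewrite (nth_map v) ?index_mem // nth_index.
Qed.

Lemma sorted_subseq_of (u t : seq nat) :
  sorted ltn u -> sorted ltn t -> {subset u <= t} -> subseq u t.
Proof.
move=> su st ut; have -> : u = [seq x <- t | x \in u].
  apply: (irr_sorted_eq ltn_trans ltnn) => //; first by apply: sorted_filter => //; apply: ltn_trans.
  move=> x; rewrite mem_filter; case: (boolP (x \in u)) => //= /ut -> //.
exact: filter_subseq.
Qed.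

Lemma index_lt_sorted (l : seq rat) x y : sorted <=%R l -> x \in l -> y \in l ->
  (x < y)%R -> index x l < index y l.
Proof.
move=> sl xl yl xy; rewrite ltnNge; apply/negP => le.
have := sorted_leq_index le_trans le_refl sl _ _ yl xl le.
by rewrite leNgt xy.
Qed.

Section Relabel.
Variables (n : nat) (dir : pred 'I_n.+1).
Local Notation P := 'I_n.+1.

Definition mapview (f : rat -> nat) t (y : pview P t) : view :=
  (f (origin n.+1), [fset f r | r in pts dir y]%fset,
   [fset (f e.1, f e.2) | e in edg dir y]%fset).

Lemma mapview_ext f g t (y : pview P t) :
  {in pts dir y, f =1 g} -> mapview f y = mapview g y.
Proof.
move=> fg; rewrite /mapview fg ?origin_pts //; congr (_, _, _); apply/fsetP=> k.
  by apply/imfsetP/imfsetP => -[r rp ->]; exists r; rewrite ?fg.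
by apply/imfsetP/imfsetP => -[e ep ->]; exists e => //; have [h1 h2] := edg_pts ep; rewrite !fg.
Qed.

Definition sorted_pts t (y : pview P t) : seq rat := sort <=%R (undup (pts dir y)).

Lemma mem_sorted_pts t (y : pview P t) : sorted_pts y =i pts dir y.
Proof. by move=> r; rewrite mem_sort mem_undup. Qed.

(** The members of [u] are handed out as identifiers in increasing order along the line, so only [u]
    and the port view matter. *)
Definition rank_view (u : seq nat) t (y : pview P t) : view :=
  mapview (fun r => nth 0 u (index r (sorted_pts y))) y.

(** This brings order-preserving identifiers into the form to which homogeneity of [l] applies. *)
Lemma mapview_rank (l : seq nat) t (y : pview P t) (f : rat -> nat) :
  sorted ltn l -> {in pts dir y &, {homo f : r r' / (r < r')%R >-> r < r'}} ->
  {in pts dir y, forall r, f r \in l} ->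
  exists u, [/\ subseq u l, size u = size (sorted_pts y) & mapview f y = rank_view u y].
Proof.
move=> sl fh fl; exists (map f (sorted_pts y)); split; first last.
- apply: mapview_ext => r ry; rewrite -mem_sorted_pts in ry.
  by rewrite (nth_map r) ?index_mem // nth_index.
- by rewrite size_map.
apply: sorted_subseq_of => //; last first.
  by move=> _ /mapP[r + ->]; rewrite mem_sorted_pts; apply: fl.
have : sorted <%R (sorted_pts y) by rewrite sort_lt_sorted undup_uniq.
have : all [in pts dir y] (sorted_pts y) by apply/allP => r; rewrite mem_sorted_pts.
case: (sorted_pts y) => //= r l'; elim: l' r => //= r' l' IH r /and3P[h1 h2 h3] /andP[rr' p].
by rewrite fh //= IH //= h2.
Qed.

Variables (L : nat) (s : forall t, pview P t).
Hypothesis coh : coherent dir s.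

Lemma view_of_tree (idf : tnode n L -> nat) (h : rat -> nat) T v :
  size (wd v) + T <= L ->
  {in ball (@tree n L) T v, forall u, idf u = h (pt dir s u)} ->
  view_of (@tree n L) idf T v = mapview (h \o fr dir s v) (st s v T).
Proof.
move=> le idfE; rewrite /view_of /mapview /= idfE ?ball_self //.
congr (_, _, _); apply/fsetP=> k; apply/imfsetP/imfsetP => /=.
- case=> u uB ->; rewrite idfE //.
  have /mapP[r ry ->] : pt dir s u \in map (fr dir s v) (pts dir (st s v T)).
    by apply/ball_pts => //; exists u.
  by exists r.
- case=> r ry ->.
  have /(ball_pts coh _ le)[u uB e] : fr dir s v r \in map (fr dir s v) (pts dir (st s v T)) by apply: map_f.
  by exists u; rewrite // idfE // e.
- case=> -[u w]; rewrite inE /= => /and3P[tuw uB wB] ->; rewrite !idfE //.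
  have /mapP[e ey [-> ->]] : (pt dir s u, pt dir s w) \in map (map_pair (fr dir s v)) (edg dir (st s v T)).
    by apply/ball_edg => //; exists u, w.
  by exists e.
- case=> e ey ->.
  have /(ball_edg coh _ le)[u [w [tuw uB wB [e1 e2]]]] :
      map_pair (fr dir s v) e \in map (map_pair (fr dir s v)) (edg dir (st s v T)) by apply: map_f.
  by exists (u, w); rewrite ?inE /= ?tuw ?uB // !idfE // e1 e2.
Qed.

End Relabel.

Lemma tree_maxdeg n L (dir : pred 'I_n.+1) (s : forall t, pview 'I_n.+1 t) :
  coherent dir s -> 0 < L -> maxdeg (@tree n L) = n.+1.
Proof.
move=> coh L0; apply/eqP; rewrite eqn_leq; apply/andP; split.
  apply/bigmax_leqP => v _; have := wd_size v; rewrite leq_eqVlt => /orP[/eqP sv|sv].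
    by rewrite leaf_deg.
  by rewrite (inner_deg coh).
by rewrite -(inner_deg (L := L) coh (v := troot n L)) // /maxdeg (leq_bigmax (troot n L)).
Qed.

Lemma ball_wd_size n L T (v u : tnode n L) :
  u \in ball (@tree n L) T v -> size (wd u) <= size (wd v) + T.
Proof.
elim: T v => [|T IH] v; first by move=> /set1P ->; rewrite addn0.
rewrite ball_step => /orP[/eqP->|/existsP[w /andP[tvw /IH]]]; first exact: leq_addr.
by case/orP: tvw => /par_size; lia.
Qed.

Lemma local_to_views (n T c : nat) (Tf : nat -> nat) (A : algorithm) :
  0 < c -> 0 < n -> odd n.+1 -> Tf n.+1 = T -> solves_odd_weak2col c Tf A ->
  exists f : pview 'I_n.+1 T -> bool, forall x : pview 'I_n.+1 T.+1,
    @pvalid 'I_n.+1 (fun i => odd i) T.+1 x -> exists i, f (x.2 i).2 != f x.1.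
Proof.
move=> c0 n0 odn TfE solv; pose dir : pred 'I_n.+1 := fun i => odd i.
(* At least the number of nodes within distance [T.+1] of the root, since these are words of at most
   that length. *)
pose M := #|{bseq T.+1 of 'I_n.+1}|.
have [N NP] := @ramsey_family nat _ (enum (pview 'I_n.+1 T)) (fun y => size (sorted_pts dir y)) M.
(* Depth [N] supplies the identifiers for Ramsey's theorem; depth [T.+1] keeps the balls around the
   root and its neighbours from being cut off. *)
pose L := maxn N T.+1; have L0 : 0 < L by rewrite leq_max orbT.
have leTL : T.+1 <= L by rewrite leq_max leqnn orbT.
pose V := tnode n L; pose col (y : pview 'I_n.+1 T) u := A #|V| n.+1 (rank_view dir u y).
have [|l [lsub lsize lhom]] := NP col (iota 0 #|V|).
  rewrite size_iota; apply: leq_trans (tree_card L n0); exact: leq_maxl.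
have lsort : sorted ltn l by apply: (subseq_sorted ltn_trans lsub); apply: iota_ltn_sorted.
have lV k : k \in l -> k < #|V| by move/(mem_subseq lsub); rewrite mem_iota.
pose f y := col y (take (size (sorted_pts dir y)) l).
exists f => x vx.
have dirs b : exists j, dir j = b.
  case: b; last by exists ord0.
  by exists (Ordinal (n0 : 1 < n.+1)).
have [s coh sx] := coherent_through dirs vx.
pose B := [set v : V | size (wd v) <= T.+1].
pose p := @pt n dir L s.
pose SB := sort <=%R (map p (enum B)).
have memSB v : v \in B -> p v \in SB by move=> vB; rewrite mem_sort map_f // mem_enum.
have sSB : size SB <= size l.
  rewrite lsize size_sort size_map -cardE.
  have sB v : v \in B -> size (wd v) <= T.+1 by rewrite inE.
  pose g (v : V) : {bseq T.+1 of 'I_n.+1} := insub_bseq T.+1 (wd v).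
  have gE v : v \in B -> g v = wd v :> seq _ by move/sB => h; rewrite /g /insub_bseq insubdK.
  rewrite -(card_in_imset (f := g) (D := B)); first exact: max_card.
  by move=> u v uB vB /(congr1 val); rewrite /= !gE //; apply: wd_inj.
pose h r := nth 0 l (index r SB).
have hl r : r \in SB -> h r \in l.
  by move=> rS; rewrite mem_nth // (leq_trans _ sSB) // index_mem.
have hlt r r' : r \in SB -> r' \in SB -> (r < r')%R -> h r < h r'.
  move=> rS rS' rr'; apply: (sorted_ltn_nth ltn_trans 0 lsort); rewrite ?inE.
  - by rewrite (leq_trans _ sSB) // index_mem.
  - by rewrite (leq_trans _ sSB) // index_mem.
  by apply: index_lt_sorted => //; apply/sort_sorted/le_total.
have hinj : {in B &, injective (fun v => h (p v))}.
  move=> u v uB vB e; apply: (pt_inj (dir := dir) (s := s)).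
  case: (ltgtP (p u) (p v)) => // lt.
    by have := hlt _ _ (memSB _ uB) (memSB _ vB) lt; rewrite e ltnn.
  by have := hlt _ _ (memSB _ vB) (memSB _ uB) lt; rewrite e ltnn.
have [|idf [idi idV idB]] := injection_extension hinj.
  by move=> v vB; apply/lV/hl/memSB.
have mdeg : maxdeg (@tree n L) = n.+1 by apply: tree_maxdeg coh L0.
have colE v : size (wd v) <= 1 ->
    A #|V| n.+1 (view_of (@tree n L) idf T v) = f (st s v T).
  move=> sv; have ballB u : u \in ball (@tree n L) T v -> u \in B.
    by move/ball_wd_size; rewrite inE; lia.
  have le : size (wd v) + T <= L by lia.
  have ptsB r : r \in pts dir (st s v T) -> fr dir s v r \in SB.
    move=> ry; have /(ball_pts coh _ le)[u uB <-] :
      fr dir s v r \in map (fr dir s v) (pts dir (st s v T)) by apply: map_f.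
    exact/memSB/ballB.
  rewrite (view_of_tree (h := h) coh le); last by move=> u /ballB uB; rewrite idB.
  have hm : {in pts dir (st s v T) &, {homo h \o fr dir s v : r r' / (r < r')%R >-> r < r'}}.
    by move=> r r' ry ry' rr' /=; apply: hlt; rewrite ?ptsB //; apply: wfr_homo.
  have hin : {in pts dir (st s v T), forall r, (h \o fr dir s v) r \in l}.
    by move=> r ry; apply/hl/ptsB.
  have [u [ul su ->]] := mapview_rank lsort hm hin.
  (* [u] and the prefix of [l] chosen by [f] are subsequences of [l] of equal length, so homogeneity
     gives them the same colour. *)
  rewrite -/(col _ u) /f; apply: lhom; rewrite ?mem_enum ?take_subseq //.
  by rewrite size_take_min; have := size_subseq ul; rewrite su => /minn_idPl ->.
have degs v : odd (deg (@tree n L) v).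
  have := wd_size v; rewrite leq_eqVlt => /orP[/eqP sv|sv]; first by rewrite leaf_deg.
  by rewrite (inner_deg coh).
have idc v : idf v < #|V| ^ c.
  apply: leq_trans (idV v) _; rewrite -{1}[#|V|]expn1 leq_pexp2l //.
  by apply/card_gt0P; exists (troot n L).
have := solv V (@tree n L) idf (@tree_simple n L) (@tree_connected n L) degs idi idc (troot n L).
rewrite mdeg TfE (inner_deg coh) // => /(_ isT)[u [tru]].
have [i [_ su _]] := nbr_at_of coh tru.
have su1 : size (wd u) <= 1 by case/orP: tru => [/par_size-> //|/par_size].

rewrite !colE // su => cu; exists i.
by rewrite -sx (stepE coh) /= (proj2 (coh T)).
Qed.

(** * Towers and the theorem *)

Fixpoint tower (m : nat) : nat := if m is m'.+1 then 2 ^ tower m' else 1.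

Lemma tower_gt0 m : 0 < tower m.
Proof. by case: m => //= m; rewrite expn_gt0. Qed.

Lemma tower_ltS m : tower m < tower m.+1.
Proof. exact: ltn_expl. Qed.

Lemma tower_add m k : tower (m + k) = iter m (expn 2) (tower k).
Proof. by elim: m => //= m ->. Qed.

Lemma log_star_aux_tower f x m : 0 < x -> m <= log_star_aux f x -> tower m <= x.
Proof.
elim: f x m => [|f IH] x [|m] x0 //=; case: (leqP x 1) => // x1 le.
have l0 : 0 < trunc_log 2 x by rewrite trunc_log_gt0.
apply: leq_trans (trunc_logP (isT : 1 < 2) x0).
by rewrite leq_exp2l // IH.
Qed.

Lemma tower_log_star_aux f x m : x <= f -> tower m <= x -> m <= log_star_aux f x.
Proof.
elim: f x m => [|f IH] x m.
  by rewrite leqn0 => /eqP ->; have := tower_gt0 m; lia.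
case: m => [//|m] xf tx; have t0 := tower_gt0 m.
have x1 : 1 < x by apply: leq_trans tx; rewrite -{1}[2]expn1 /= leq_exp2l.
have x0 : 0 < x by lia.
rewrite [log_star_aux _ _]/= ifN -?ltnNge // ltnS; apply: IH; last exact: trunc_log_max.
rewrite -ltnS; apply: leq_trans xf; apply: leq_trans (trunc_logP (isT : 1 < 2) x0).
exact: ltn_expl.
Qed.

Lemma expn2_ge4 B : 4 <= B -> 4 <= 2 ^ B.
Proof. by move=> B4; apply: leq_trans (ltnW (ltn_expl _ _)). Qed.

Lemma sqr_le_expn2 x : 4 <= x -> x * x <= 2 ^ x.
Proof.
elim: x => // x IH; rewrite leq_eqVlt => /orP[/eqP <- //|]; rewrite ltnS => x4.
by have := IH x4; rewrite expnS; nia.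
Qed.

Lemma gap_seq_le m a s : gap_seq m a s <= (2 * m + a + 2) ^ s.
Proof.
elim: s => //= s IH; have : 0 < (2 * m + a + 2) ^ s by rewrite expn_gt0; lia.
by rewrite expnS; nia.
Qed.

(** Two exponentials bound [2 ^ (4 * a)], two more the number [m] of types, a fifth the base of the
    power from [gap_seq_le], and the last two a power of it with exponent m + 1. *)
Lemma bounds_step_le p B : 4 <= B -> p.1 <= B -> p.2 <= B ->
  (bounds_step p).1 <= iter 7 (expn 2) B /\ (bounds_step p).2 <= iter 7 (expn 2) B.
Proof.
case: p => a b /= B0_4 aB bB.
have next x : 4 <= x -> exists y, [/\ y = 2 ^ x, 4 <= y, x < y & x * x <= y].
  by move=> x4; exists (2 ^ x); split=> //; [exact: expn2_ge4 | exact: ltn_expl | exact: sqr_le_expn2].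
have [B1 [<- B1_4 B01 sq0]] := next B B0_4.
have [B2 [E2 B2_4 B12 sq1]] := next B1 B1_4; rewrite -E2.
have [B3 [E3 B3_4 B23 sq2]] := next B2 B2_4; rewrite -E3.
have [B4 [E4 B4_4 B34 sq3]] := next B3 B3_4; rewrite -E4.
have [B5 [E5 B5_4 B45 sq4]] := next B4 B4_4; rewrite -E5.
have [B6 [E6 B6_4 B56 sq5]] := next B5 B5_4; rewrite -E6.
have [B7 [E7 B7_4 B67 sq6]] := next B6 B6_4; rewrite -E7.
have hB : 2 ^ (4 * a) <= B2 by rewrite E2 leq_exp2l //; nia.
move: (2 ^ (4 * a)) hB => h hB.
have mB : 2 * 2 ^ h <= B4 by rewrite -expnS E4 leq_exp2l //; lia.
move: (2 * 2 ^ h) mB => m mB; split; first by rewrite E7 leq_exp2l //; lia.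
have qB : 2 * m + b.+1 * h + 2 <= B5.
  have : b.+1 * h <= B2 * B2 by apply: leq_mul; lia.
  by nia.
apply: leq_trans (_ : B5 ^ m.+1 <= _).
  rewrite expnS; apply: leq_mul; first by lia.
  apply: leq_trans (gap_seq_le _ _ _) _.
  by case: (posnP m) => [-> //|m0]; rewrite leq_exp2r.
rewrite E5 -expnM E7 leq_exp2l // E6; apply: leq_trans (_ : B5 * B5 <= _); last by rewrite -E6.
by apply: leq_mul; lia.
Qed.

(** The offset 2 is there because [tower 2] is 4, which exceeds the initial bounds and starts the
    estimates at 4. *)
Lemma bounds_le t :
  (iter t bounds_step (2, 0)).1 <= tower (7 * t + 2) /\
  (iter t bounds_step (2, 0)).2 <= tower (7 * t + 2).
Proof.
elim: t => [//|t [IH1 IH2]]; rewrite iterS.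
have -> : 7 * t.+1 + 2 = 7 + (7 * t + 2) by lia.
rewrite (tower_add 7); apply: bounds_step_le => //.
elim: (7 * t) => // k IHk; exact: leq_trans IHk (ltnW (tower_ltS _)).
Qed.

Lemma parity_class_card k b : k <= #|[set i : 'I_(k.*2).+1 | odd i == b]|.
Proof.
have lt (j : 'I_k) : j.*2 + b < (k.*2).+1 by case: b; have := ltn_ord j; lia.
pose g j := Ordinal (lt j).
have gi : injective g by move=> i j [] e; apply: val_inj; move: e => /=; lia.
rewrite -[k in k <= _]card_ord -(card_imset predT gi); apply: subset_leq_card.
apply/subsetP=> _ /imsetP[j _ ->]; rewrite inE /= oddD odd_double.
by case: b {lt g gi}.
Qed.

Theorem theorem9 (c : nat) (Hc : 0 < c) :
  ~ (exists (T : nat -> nat) (A : algorithm),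
        little_o_log_star T /\ solves_odd_weak2col c T A).
Proof.
case=> T [A [oT solv]].
(* Averaging [14 * T <= log_star] and [22 <= log_star] gives [7 * T + 11 <= log_star]: 7 (T + 1) + 2
   levels for radius T + 1, and two more to pass from the degree to the size of a parity class. *)
have [D0 D0P] := oT 14 isT.
have big m : exists D1, forall D, D1 <= D -> m <= log_star D.
  by exists (tower m) => D; apply: tower_log_star_aux.
have [D1 D1P] := big 22.
pose k := (D0 + D1).+1; pose n := k.*2.
have h0 : 14 * T n.+1 <= log_star n.+1 by apply: D0P; rewrite /n /k; lia.
have h1 : 22 <= log_star n.+1 by apply: D1P; rewrite /n /k; lia.
have [||f fP] := local_to_views Hc _ _ (erefl (T n.+1)) solv; first by rewrite double_gt0.
  by rewrite /= odd_double.
case: (unsolvable_views (C := bool) (K := 0) _ (weak_coloring_solvable fP)) => b.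
rewrite card_bool; apply: leq_trans (parity_class_card k b).
apply: leq_ltn_trans (proj2 (bounds_le _)) _.
set m := 7 * _ + 2.
have hm : tower m.+2 <= n.+1.
  by apply: (@log_star_aux_tower n.+1) => //; rewrite -/(log_star n.+1) /m; lia.
have := leq_trans (tower_ltS m.+1) hm => h3; have h2 := tower_ltS m.
have : 2 * tower m.+1 <= tower m.+2.
  by rewrite /= -/(tower m.+1); case: (tower m.+1) => // x; rewrite expnS leq_mul2l ltn_expl.
by rewrite /n in hm; lia.
Qed.
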